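(* Let $\mathcal V$ be a real vector space with basis $\alpha,\sigma_1,\sigma_2$ and positive semidefinite symmetric form with $(\alpha,\alpha)=2$ and radical $\mathcal V^0=\mathbb R\sigma_1\oplus\mathbb R\sigma_2$. Let $R=\Lambda\cup(\pm\alpha+S)$ be the elliptic root system of type $A_1$ with $\Lambda=\mathbb Z\sigma_1\oplus\mathbb Z\sigma_2$ and $S=2\Lambda\cup(\sigma_1+2\Lambda)\cup(\sigma_2+2\Lambda)$. Put $P=\{\alpha,\sigma_1-\alpha,\sigma_2-\alpha\}$, $P^\pm=P\cup(-P)$. Let $\widehat{\mathcal L}$ be the complex Lie algebra defined by generators $\widehat X_\beta,\widehat H_\beta$ ($\beta\in P^\pm$), $\widehat d_1,\widehat d_2$ and relations (I) $\sum_{i=1}^k\widehat H_{\beta_i}=\widehat H_{\sum_i\beta_i}$ if $\beta_1,\dots,\beta_k,\sum_i\beta_i\in P$; (II) $[\widehat H_\beta,\widehat H_\gamma]=0$, $\beta,\gamma\in P^\pm$; (III) $[\widehat H_\beta,\widehat X_\gamma]=(\gamma,\beta^\vee)\widehat X_\gamma$, $\beta,\gamma\in P^\pm$; (IV) $[\widehat X_\beta,\widehat X_{-\beta}]=\widehat H_\beta$, $\beta\in P^\pm$; (V) $[\widehat X_{\beta_1},\dots,\widehat X_{\beta_n}]=0$ whenever $\beta_i\in P^\pm$ and $\sum_{i=1}^n\beta_i\notin R$; (VI) $[\widehat d_i,\widehat X_\beta]=\lambda_i(\beta)\widehat X_\beta$, $[\widehat d_i,\widehat d_j]=[\widehat d_i,\widehat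 H_\beta]=0$, $\beta\in P^\pm$, $1\le i,j\le2$, and let $\widehat{\mathcal H}=\mathrm{span}_{\mathbb C}\{\widehat H_\beta,\widehat d_1,\widehat d_2\mid\beta\in P^\pm\}$. Then $(\widehat{\mathcal L},\widehat{\mathcal H})$ is an elliptic Lie algebra with root system $R$. Moreover $\dim\widehat{\mathcal H}=5$ and $\dim\widehat{\mathcal L}_\beta=1$ for $\beta\in R^\times$.
   Context: $\beta^\vee=2\beta/(\beta,\beta)$ for $(\beta,\beta)\ne0$; $R^0=R\cap\mathcal V^0$, $R^\times=R\setminus R^0$. $\lambda_1,\lambda_2\in\mathcal V^*$ are given by $\lambda_i(\sigma_j)=\delta_{ij}$, $\lambda_i(\alpha)=0$. $[x_1,\dots,x_n]$ means $[x_1,[x_2,[\dots,[x_{n-1},x_n]\cdots]]]$. Extended affine root system: a subset $R$ of a finite-dimensional real space $\mathcal V$ with positive semidefinite symmetric form of radical $\mathcal V^0$ such that $\langle R\rangle$ (additive subgroup generated) is a full lattice in $\mathcal V$; $(\beta,\gamma^\vee)\in\mathbb Z$ for $\beta,\gamma\in R^\times$; $\beta-(\beta,\gamma^\vee)\gamma\in R$ for $\gamma\in R^\times,\beta\in R$; $R^0=\mathcal V^0\cap(R^\times-R^\times)$; $\gamma\in R^\times\Rightarrow2\gamma\notin R$; $R^\times$ is nonempty and not a disjoint union of two nonempty mutually orthogonal subsets. It is an elliptic root system if $\dim\mathcal V^0=2$. Elliptic Lie algebra: let $\mathcal L$ be a complex Lie algebra containing a subalgebra $\mathcal H$ with $\mathcal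 L=\sum_{\beta\in\mathcal H^*}\mathcal L_\beta$, $\mathcal L_\beta=\{x\mid[h,x]=\beta(h)x\ \forall h\in\mathcal H\}$. Its root system is $\{\beta\in\mathcal H^*\mid\mathcal L_\beta\neq\{0\}\}$; $(\mathcal L,\mathcal H)$ is elliptic if this is an elliptic root system with respect to a symmetric positive semidefinite form on its real span. Here $\beta\in\mathcal V$ is regarded as the functional on $\widehat{\mathcal H}$ with $\beta(\widehat H_\gamma)=(\beta,\gamma^\vee)$ ($\gamma\in P^\pm$), $\beta(\widehat d_i)=\lambda_i(\beta)$; this identification is well defined and injective. *)

(* Defs.v *)
From HB Require Import structures.
From mathcomp Require Import all_boot all_order all_algebra generic_quotient.
From mathcomp Require Import boolp classical_sets functions reals.
From mathcomp Require Import complex.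
Set Implicit Arguments.
Unset Strict Implicit.
Unset Printing Implicit Defensive.
Import Order.TTheory GRing.Theory Num.Theory.
Local Open Scope classical_set_scope.
Local Open Scope ring_scope.
Local Open Scope quotient_scope.
Local Open Scope complex_scope.

Section LinearAlgebra.
Context {K : pzRingType} {M : lmodType K}.

Definition lspan (A : set M) : set M :=
  [set x | exists n (c : 'I_n -> K) (a : 'I_n -> M),
     (forall i, A (a i)) /\ x = \sum_(i < n) c i *: a i].

Definition is_basis (V : set M) n (b : 'I_n -> M) :=
  V = lspan (range b) /\
  forall c : 'I_n -> K, \sum_(i < n) c i *: b i = 0 -> forall i, c i = 0.

Definition has_dim (V : set M) n := exists b : 'I_n -> M, is_basis V b.

End LinearAlgebra.

Definition zspan (M : zmodType) (A : set M) : set M :=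
  [set x | exists n (c : 'I_n -> int) (a : 'I_n -> M),
     (forall i, A (a i)) /\ x = \sum_(i < n) a i *~ c i].

(* [V] is a subspace of an arbitrary real vector space [W], so
    that the same definition applies to a space [V] given abstractly
    ([V = setT]) and to the real span of a set of complex functionals.  Only
    the values of the form [B] on [V] are relevant. *)

Section RootSystems.
Context {R : realType} {W : lmodType R}.
Implicit Types (V Rs : set W) (B : W -> W -> R).

Definition psd_symmetric_form V B :=
  [/\ forall (a : R) u v w, V u -> V v -> V w ->
        B (a *: u + v) w = a * B u w + B v w,
      forall u v, V u -> V v -> B u v = B v u
    & forall u, V u -> 0 <= B u u].

Definition radical V B : set W := [set v | V v /\ forall w, V w -> B v w = 0].

Definition coroot B (g : W) : W := (2 / B g g) *: g.

Definition isotropic_roots V B Rs : set W := Rs `&` radical V B.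
Definition anisotropic_roots V B Rs : set W := Rs `\` isotropic_roots V B Rs.

Record extended_affine_root_system V B Rs : Prop := {
  ears_findim : exists n, has_dim V n;
  ears_form : psd_symmetric_form V B;
  ears_sub : Rs `<=` V;
  ears_lattice : exists n (b : 'I_n -> W), is_basis V b /\
    zspan Rs = zspan (range b);
  ears_int : forall b g, anisotropic_roots V B Rs b ->
    anisotropic_roots V B Rs g -> B b (coroot B g) \is a Num.int;
  ears_refl : forall b g, Rs b -> anisotropic_roots V B Rs g ->
    Rs (b - B b (coroot B g) *: g);
  ears_isotropic : isotropic_roots V B Rs =
    radical V B `&` [set x | exists b g, [/\ anisotropic_roots V B Rs b,
                               anisotropic_roots V B Rs g & x = b - g]];
  ears_reduced : forall g, anisotropic_roots V B Rs g -> ~ Rs (2 *: g);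
  ears_nonempty : anisotropic_roots V B Rs !=set0;
  ears_irreducible : ~ exists A1 A2 : set W,
    [/\ A1 !=set0, A2 !=set0, A1 `&` A2 = set0,
        anisotropic_roots V B Rs = A1 `|` A2
      & forall x y, A1 x -> A2 y -> B x y = 0] }.

Definition elliptic_root_system V B Rs :=
  extended_affine_root_system V B Rs /\ has_dim (radical V B) 2.

End RootSystems.

HB.mixin Record Lmodule_isLie (K : comNzRingType) L of GRing.Lmodule K L := {
  lie : L -> L -> L;
  lie_linearl : forall (a : K) (x y z : L),
    lie (a *: x + y) z = a *: lie x z + lie y z;
  lie_linearr : forall (a : K) (x y z : L),
    lie z (a *: x + y) = a *: lie z x + lie z y;
  liexx : forall x : L, lie x x = 0;
  lie_jacobi : forall x y z : L,
    lie x (lie y z) + lie y (lie z x) + lie z (lie x y) = 0 }.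

#[short(type="lieAlgType")]
HB.structure Definition LieAlgebra (K : comNzRingType) :=
  { L of GRing.Lmodule K L & Lmodule_isLie K L }.

(* The Lie algebra presented by generators [X] and relations [rel]: formal
    Lie words modulo the least congruence that contains [rel] and makes the
    quotient a Lie algebra over [K].  Its universal property is
    [presented_lie_up] below. *)

Inductive lie_word (K X : Type) :=
  | LGen of X
  | LZero
  | LAdd of lie_word K X & lie_word K X
  | LScale of K & lie_word K X
  | LBr of lie_word K X & lie_word K X.
Arguments LGen {K X} x.
Arguments LZero {K X}.

HB.instance Definition _ (K X : Type) := gen_eqMixin (lie_word K X).
HB.instance Definition _ (K X : Type) := gen_choiceMixin (lie_word K X).

Section Presentation.
Variables (K : comNzRingType) (X : Type).
Local Notation word := (lie_word K X).
Variable rel : word -> word -> Prop.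

Inductive lie_cong : word -> word -> Prop :=
  | lc_rel u v : rel u v -> lie_cong u v
  | lc_refl u : lie_cong u u
  | lc_sym u v : lie_cong u v -> lie_cong v u
  | lc_trans u v w : lie_cong u v -> lie_cong v w -> lie_cong u w
  | lc_add u u' v v' : lie_cong u u' -> lie_cong v v' ->
      lie_cong (LAdd u v) (LAdd u' v')
  | lc_scale a u u' : lie_cong u u' -> lie_cong (LScale a u) (LScale a u')
  | lc_br u u' v v' : lie_cong u u' -> lie_cong v v' ->
      lie_cong (LBr u v) (LBr u' v')
  | lc_addA u v w : lie_cong (LAdd u (LAdd v w)) (LAdd (LAdd u v) w)
  | lc_addC u v : lie_cong (LAdd u v) (LAdd v u)
  | lc_add0 u : lie_cong (LAdd LZero u) u
  | lc_addN u : lie_cong (LAdd (LScale (-1) u) u) LZero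
  | lc_scaleA a b u : lie_cong (LScale a (LScale b u)) (LScale (a * b) u)
  | lc_scale1 u : lie_cong (LScale 1 u) u
  | lc_scaleDr a u v :
      lie_cong (LScale a (LAdd u v)) (LAdd (LScale a u) (LScale a v))
  | lc_scaleDl a b u :
      lie_cong (LScale (a + b) u) (LAdd (LScale a u) (LScale b u))
  | lc_br_linl a u v w :
      lie_cong (LBr (LAdd (LScale a u) v) w)
               (LAdd (LScale a (LBr u w)) (LBr v w))
  | lc_br_linr a u v w :
      lie_cong (LBr w (LAdd (LScale a u) v))
               (LAdd (LScale a (LBr w u)) (LBr w v))
  | lc_brxx u : lie_cong (LBr u u) LZero
  | lc_jacobi u v w :
      lie_cong (LAdd (LAdd (LBr u (LBr v w)) (LBr v (LBr w u)))
                     (LBr w (LBr u v))) LZero.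

Definition lie_congb (u v : word) : bool := `[< lie_cong u v >].

Lemma lie_congb_equiv : equiv_class_of lie_congb.
Proof.
split.
- by move=> u; apply/asboolP/lc_refl.
- by move=> u v; apply/asboolP/asboolP; apply: lc_sym.
- move=> v u w /asboolP uv /asboolP vw; apply/asboolP; exact: lc_trans vw.
Qed.

Canonical lie_cong_equiv := EquivRelPack lie_congb_equiv.

Definition presented_lie := {eq_quot lie_cong_equiv}.
HB.instance Definition _ := Choice.on presented_lie.

Definition lie_class (u : word) : presented_lie := \pi_presented_lie u.
Definition lie_gen (x : X) : presented_lie := lie_class (LGen x).

Lemma lie_classP u v : lie_class u = lie_class v <-> lie_cong u v.
Proof. by split=> [/eqmodP/asboolP|uv]; last by apply/eqmodP/asboolP. Qed.

Lemma lie_class_repr u : lie_cong (repr (lie_class u)) u.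
Proof. by apply/lie_classP; rewrite /lie_class reprK. Qed.

Lemma lie_class_ind (Q : presented_lie -> Prop) :
  (forall u, Q (lie_class u)) -> forall x, Q x.
Proof. by move=> Qpi x; rewrite -[x]reprK; apply: Qpi. Qed.

Definition pl_add (x y : presented_lie) := lie_class (LAdd (repr x) (repr y)).
Definition pl_scale (a : K) (x : presented_lie) := lie_class (LScale a (repr x)).
Definition pl_br (x y : presented_lie) := lie_class (LBr (repr x) (repr y)).

Lemma pl_addE u v : pl_add (lie_class u) (lie_class v) = lie_class (LAdd u v).
Proof. by apply/lie_classP/lc_add; apply: lie_class_repr. Qed.
Lemma pl_scaleE a u : pl_scale a (lie_class u) = lie_class (LScale a u).
Proof. by apply/lie_classP/lc_scale; apply: lie_class_repr. Qed.
Lemma pl_brE u v : pl_br (lie_class u) (lie_class v) = lie_class (LBr u v).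
Proof. by apply/lie_classP/lc_br; apply: lie_class_repr. Qed.

Lemma pl_addA : associative pl_add.
Proof.
do 3![elim/lie_class_ind=> ?]; rewrite !pl_addE; exact/lie_classP/lc_addA.
Qed.
Lemma pl_addC : commutative pl_add.
Proof. do 2![elim/lie_class_ind=> ?]; rewrite !pl_addE; exact/lie_classP/lc_addC. Qed.
Lemma pl_add0 : left_id (lie_class LZero) pl_add.
Proof. elim/lie_class_ind=> ?; rewrite !pl_addE; exact/lie_classP/lc_add0. Qed.
Lemma pl_addN : left_inverse (lie_class LZero) (pl_scale (-1)) pl_add.
Proof.
elim/lie_class_ind=> ?; rewrite pl_scaleE pl_addE; exact/lie_classP/lc_addN.
Qed.

HB.instance Definition _ := GRing.isZmodule.Build presented_lie
  pl_addA pl_addC pl_add0 pl_addN.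

Lemma pl_scaleA a b x : pl_scale a (pl_scale b x) = pl_scale (a * b) x.
Proof.
elim/lie_class_ind: x => ?; rewrite !pl_scaleE; exact/lie_classP/lc_scaleA.
Qed.
Lemma pl_scale1 : left_id 1 pl_scale.
Proof. elim/lie_class_ind=> ?; rewrite pl_scaleE; exact/lie_classP/lc_scale1. Qed.
Lemma pl_scaleDr : right_distributive pl_scale +%R.
Proof.
move=> a; do 2![elim/lie_class_ind=> ?].
by rewrite /GRing.add /= !(pl_addE, pl_scaleE); apply/lie_classP/lc_scaleDr.
Qed.
Lemma pl_scaleDl x : {morph pl_scale^~ x : a b / a + b}.
Proof.
move=> a b; elim/lie_class_ind: x => ?; rewrite !pl_scaleE [RHS]pl_addE.
exact/lie_classP/lc_scaleDl.
Qed.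

HB.instance Definition _ := GRing.Zmodule_isLmodule.Build K presented_lie
  pl_scaleA pl_scale1 pl_scaleDr pl_scaleDl.

Lemma lie_classD u v : lie_class (LAdd u v) = lie_class u + lie_class v.
Proof. by rewrite -pl_addE. Qed.
Lemma lie_classZ a u : lie_class (LScale a u) = a *: lie_class u.
Proof. by rewrite -pl_scaleE. Qed.
Lemma lie_class0 : lie_class LZero = 0.
Proof. by []. Qed.

Lemma pl_br_linl a x y z : pl_br (a *: x + y) z = a *: pl_br x z + pl_br y z.
Proof.
elim/lie_class_ind: x => u; elim/lie_class_ind: y => v.
elim/lie_class_ind: z => w.
rewrite -lie_classZ -lie_classD !pl_brE -lie_classZ -lie_classD.
exact/lie_classP/lc_br_linl.
Qed.
Lemma pl_br_linr a x y z : pl_br z (a *: x + y) = a *: pl_br z x + pl_br z y.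
Proof.
elim/lie_class_ind: x => u; elim/lie_class_ind: y => v.
elim/lie_class_ind: z => w.
rewrite -lie_classZ -lie_classD !pl_brE -lie_classZ -lie_classD.
exact/lie_classP/lc_br_linr.
Qed.
Lemma pl_brxx x : pl_br x x = 0.
Proof. elim/lie_class_ind: x => u; rewrite pl_brE; exact/lie_classP/lc_brxx. Qed.
Lemma pl_jacobi x y z :
  pl_br x (pl_br y z) + pl_br y (pl_br z x) + pl_br z (pl_br x y) = 0.
Proof.
elim/lie_class_ind: x => u; elim/lie_class_ind: y => v.
elim/lie_class_ind: z => w.
rewrite !pl_brE -!lie_classD; exact/lie_classP/lc_jacobi.
Qed.

HB.instance Definition _ := Lmodule_isLie.Build K presented_lie
  pl_br_linl pl_br_linr pl_brxx pl_jacobi.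

Lemma lie_class_br u v : lie_class (LBr u v) = lie (lie_class u) (lie_class v).
Proof. by rewrite -[RHS]/(pl_br _ _) pl_brE. Qed.

Fixpoint lie_eval (L : lieAlgType K) (g : X -> L) (u : word) : L :=
  match u with
  | LGen x => g x
  | LZero => 0
  | LAdd u v => lie_eval g u + lie_eval g v
  | LScale a u => a *: lie_eval g u
  | LBr u v => lie (lie_eval g u) (lie_eval g v)
  end.

Lemma presented_lie_up (L : lieAlgType K) (g : X -> L) :
  (forall u v, rel u v -> lie_eval g u = lie_eval g v) ->
  exists! f : presented_lie -> L,
    [/\ linear f, forall x y, f (lie x y) = lie (f x) (f y)
      & forall x, f (lie_gen x) = g x].
Proof.
move=> grel.
have gcong u v : lie_cong u v -> lie_eval g u = lie_eval g v.
  elim=> //=.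
  - by move=> ? ? ? _ -> _ ->.
  - by move=> ? ? ? ? _ -> _ ->.
  - by move=> ? ? ? _ ->.
  - by move=> ? ? ? ? _ -> _ ->.
  - by move=> *; rewrite addrA.
  - by move=> *; rewrite addrC.
  - by move=> *; rewrite add0r.
  - by move=> *; rewrite scaleN1r addNr.
  - by move=> *; rewrite scalerA.
  - by move=> *; rewrite scale1r.
  - by move=> *; rewrite scalerDr.
  - by move=> *; rewrite scalerDl.
  - by move=> *; rewrite lie_linearl.
  - by move=> *; rewrite lie_linearr.
  - by move=> *; rewrite liexx.
  - by move=> *; rewrite lie_jacobi.
pose f (x : presented_lie) := lie_eval g (repr x).
have fE u : f (lie_class u) = lie_eval g u by apply/gcong/lie_class_repr.
exists f; split=> [|h [hlin hbr hgen]].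
  split=> [a|x y|x]; last exact: fE.
    do 2![elim/lie_class_ind=> ?].
    by rewrite -lie_classZ -lie_classD !fE.
  elim/lie_class_ind: x => u; elim/lie_class_ind: y => v.
  by rewrite -lie_class_br !fE.
have h0 : h 0 = 0.
  by have /eqP := hlin 1 0 0; rewrite !scale1r addr0 eq_sym -subr_eq0 addrK => /eqP.
apply/funext; elim/lie_class_ind=> u; rewrite fE.
elim: u => [x||u IHu v IHv|a u IHu|u IHu v IHv] /=.
- by rewrite -hgen.
- by rewrite lie_class0 h0.
- by rewrite lie_classD -[lie_class u]scale1r (hlin 1) scale1r IHu IHv.
- by have := hlin a (lie_class u) 0; rewrite h0 !addr0 lie_classZ IHu.
- by rewrite lie_class_br hbr IHu IHv.
Qed.

End Presentation.

Fixpoint nested_br (K X : Type) (u : lie_word K X) (s : seq (lie_word K X)) :=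
  if s is v :: s' then LBr u (nested_br v s') else u.

(* Functionals on [H] are valued in [Rcomplex R], i.e.
    R[i] with its structure of a real vector space, so that [functional H] is
    a real vector space. *)

Section EllipticLieAlgebra.
Context {R : realType} {L : lieAlgType R[i]}.
Implicit Types H : set L.

Definition functional H := set_type H -> Rcomplex R.
HB.instance Definition _ H := GRing.Lmodule.on (functional H).

Definition dual H : set (functional H) :=
  [set f | forall (a : R[i]) (x y z : H),
     val z = a *: val x + val y -> f z = a * (f x : R[i]) + f y].

Definition is_subalgebra H :=
  H 0 /\ (forall (a : R[i]) x y, H x -> H y -> H (a *: x + y)) /\
  forall x y, H x -> H y -> H (lie x y).

Definition weight_space H (f : functional H) : set L :=
  [set x | forall h : H, lie (val h) x = (f h : R[i]) *: x].

Definition weight_decomposition H :=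
  forall x : L, exists n (f : 'I_n -> functional H) (y : 'I_n -> L),
    (forall i, dual (f i) /\ weight_space (f i) (y i)) /\ x = \sum_(i < n) y i.

Definition root_system H : set (functional H) :=
  [set f | dual f /\ exists2 x, weight_space f x & x != 0].

(* [(L, H)] is elliptic when this holds for some form [B]. *)
Definition elliptic_lie_algebra_wrt H (B : functional H -> functional H -> R) :=
  [/\ is_subalgebra H, weight_decomposition H
    & elliptic_root_system (lspan (@root_system H)) B (@root_system H)].

End EllipticLieAlgebra.

Section A1.
Context {R : realType} {V : vectType R}.
Variables (alpha sigma1 sigma2 : V) (form : V -> V -> R).

Definition A1_Lambda : set V :=
  [set x | exists m n : int, x = sigma1 *~ m + sigma2 *~ n].

Definition A1_S : set V :=
  [set x | exists2 l, A1_Lambda l &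
     [\/ x = l *+ 2, x = sigma1 + l *+ 2 | x = sigma2 + l *+ 2]].

Definition A1_R : set V :=
  A1_Lambda `|` [set x | exists2 s, A1_S s & x = alpha + s \/ x = - alpha + s].

Definition A1_P : set V := [set alpha; sigma1 - alpha; sigma2 - alpha].
Definition A1_Ppm : set V := A1_P `|` [set - b | b in A1_P].

(* [A1_lambda i] is the dual basis vector of sigma_(i+1). *)
Definition A1_lambda (i : 'I_2) (v : V) : R :=
  coord [tuple alpha; sigma1; sigma2] (lift ord0 i) v.

Inductive A1_gen := gX of A1_Ppm | gH of A1_Ppm | gd of 'I_2.

Local Notation "''X_' b" := (LGen (gX b)) (at level 8, b at level 2).
Local Notation "''H_' b" := (LGen (gH b)) (at level 8, b at level 2).
Local Notation "''d_' i" := (LGen (gd i)) (at level 8, i at level 2).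
Local Notation "[: u , v ]" := (LBr u v).

Inductive A1_rel : lie_word R[i] A1_gen -> lie_word R[i] A1_gen -> Prop :=
  | A1_rel1 (s : seq A1_Ppm) (g : A1_Ppm) :
      (forall b, b \in s -> A1_P (val b)) -> A1_P (val g) ->
      \sum_(b <- s) val b = val g ->
      A1_rel (\big[@LAdd _ _/LZero]_(b <- s) 'H_b) 'H_g
  | A1_rel2 (b g : A1_Ppm) : A1_rel [: 'H_b, 'H_g] LZero
  | A1_rel3 (b g : A1_Ppm) :
      A1_rel [: 'H_b, 'X_g]
             (LScale (form (val g) (coroot form (val b)))%:C 'X_g)
  | A1_rel4 (b b' : A1_Ppm) :
      val b' = - val b -> A1_rel [: 'X_b, 'X_b'] 'H_b
  | A1_rel5 (b : A1_Ppm) (s : seq A1_Ppm) :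
      ~ A1_R (\sum_(c <- b :: s) val c) ->
      A1_rel (nested_br 'X_b [seq 'X_c | c <- s]) LZero
  | A1_rel6X (i : 'I_2) (b : A1_Ppm) :
      A1_rel [: 'd_i, 'X_b] (LScale (A1_lambda i (val b))%:C 'X_b)
  | A1_rel6d (i j : 'I_2) : A1_rel [: 'd_i, 'd_j] LZero
  | A1_rel6H (i : 'I_2) (b : A1_Ppm) : A1_rel [: 'd_i, 'H_b] LZero.

Definition A1_Lhat : lieAlgType R[i] := presented_lie A1_rel.

Definition Hhat (b : A1_Ppm) : A1_Lhat := lie_gen A1_rel (gH b).
Definition dhat (i : 'I_2) : A1_Lhat := lie_gen A1_rel (gd i).

Definition A1_Hhat : set A1_Lhat := lspan (range Hhat `|` range dhat).

Definition regarded_as (b : V) (f : functional A1_Hhat) : Prop :=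
  [/\ dual f,
      forall (g : A1_Ppm) (h : A1_Hhat), val h = Hhat g ->
        f h = (form b (coroot form (val g)))%:C
    & forall (i : 'I_2) (h : A1_Hhat), val h = dhat i ->
        f h = (A1_lambda i b)%:C].

End A1.
Arguments A1_Hhat {R V} alpha sigma1 sigma2 form.

(* Main.v *)
Require Import Defs.
From HB Require Import structures.
From mathcomp Require Import all_boot all_order all_algebra.
From mathcomp Require Import boolp classical_sets functions reals.
From mathcomp Require Import complex.
From mathcomp Require Import freeg.
From mathcomp Require Import ring zify.
Set Implicit Arguments.
Unset Strict Implicit.
Unset Printing Implicit Defensive.
Import Order.TTheory GRing.Theory Num.Theory.
Local Open Scope classical_set_scope.
Local Open Scope ring_scope.

(** Put [alpha_0 = alpha] and [alpha_i = alpha - sigma_i] for [i = 1, 2], so that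
    the generators are [x_i] of weight [alpha_i] and [y_i] of weight [- alpha_i],
    with [h_i = [x_i, y_i]].  A combination of the [alpha_i] with integer
    coefficients of sum 1 is a root exactly when its coefficients are not all
    odd; this makes the situation symmetric in the three indices.  Call level of
    a weight the common eigenvalue of the [h_i]: on the presented algebra it is
    -2, 0 or 2, because all weights are roots ([atomicT], [cubic_H]).

    Root spaces have dimension at most one.  Let [D_ij = ad [x_i, y_j]],
    [Qx_i = (ad x_i)^2 / 2] and [Qy_j = (ad y_j)^2 / 2].  As [ad x_i] has cube
    zero, [Qx_i] and [Qy_i] are mutually inverse bijections between the levels
    -2 and 2 ([quadK]).  Fundamental identities: [D_ij] anticommutes with
    [Qx_i], [Qx_j], [Qy_i], [Qy_j] and commutes with [Qx_k], [Qy_k] for the third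
    index, where [D_ij x_k = 0] as [alpha_i - alpha_j + alpha_k] is not a root.
    Consequently every iterated bracket of level 2 is obtained from the [x_p]
    by these operators ([lie_lie_bottom]).  Moreover [D_ij x_j = 2 x_i] and
    [D_ij x_i = 2 T_ij x_j] with [T_ij = Qx_i Qy_j] ([Dj], [Di]), and the [T_ij]
    commute ([shift_comm]).  Hence level 2 is spanned by the vectors
    [T_10^a T_20^b x_p], whose weights are pairwise distinct ([line_D],
    [bracket_shape], [vwt_inj]); level -2 follows by applying [Qy_0].

    Nothing collapses.  The [T_ij] are invertible, and [[x_j, [y_j, v]] = 2 v] at
    level 2, so all root spaces are nonzero as soon as the [x_p] are
    ([root_space_neq0]).  For this, and for the independence of the [h_i] and
    [d_i], the algebra is mapped to a concrete one: the symplectic Lie algebra of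
    2 x 2 matrices over the quantum torus [t_1 t_2 = - t_2 t_1], extended by two
    central elements and two degree derivations ([torus]).  There
    [x_i = e t_i^-1] and [y_i = f t_i] (with [t_0 = 1]); an element negated by the
    symplectic anti-involution and whose weight is not a root vanishes
    ([odd_weight_eq0]), so the relations hold in that algebra ([gen_image_rel]).

    The root system axioms are checked in [V] ([A1_elliptic]) and transported to
    functionals on the Cartan subalgebra ([elliptic_image]). *)

(** * Computing in Lie algebras *)

Local Notation "x ∙ y" := (lie x y) (at level 38, right associativity).

Section LieBasics.
Context {K : comNzRingType} {L : lieAlgType K}.
Implicit Types x y z : L.

Lemma lieDl x y z : (x + y) ∙ z = x ∙ z + y ∙ z.
Proof. by have := lie_linearl 1 x y z; rewrite !scale1r. Qed.

Lemma lieDr x y z : z ∙ (x + y) = z ∙ x + z ∙ y.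
Proof. by have := lie_linearr 1 x y z; rewrite !scale1r. Qed.

Lemma lie0l x : 0 ∙ x = 0.
Proof. by apply: (addrI (0 ∙ x)); rewrite -lieDl !addr0. Qed.

Lemma lie0r x : x ∙ 0 = 0.
Proof. by apply: (addrI (x ∙ 0)); rewrite -lieDr !addr0. Qed.

Lemma lieZl a x y : (a *: x) ∙ y = a *: (x ∙ y).
Proof. by have := lie_linearl a x 0 y; rewrite lie0l !addr0. Qed.

Lemma lieZr a x y : x ∙ (a *: y) = a *: (x ∙ y).
Proof. by have := lie_linearr a y 0 x; rewrite lie0r !addr0. Qed.

Lemma lieNl x y : (- x) ∙ y = - (x ∙ y).
Proof. by rewrite -scaleN1r lieZl scaleN1r. Qed.

Lemma lieNr x y : x ∙ (- y) = - (x ∙ y).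
Proof. by rewrite -scaleN1r lieZr scaleN1r. Qed.

Lemma lieC x y : x ∙ y = - (y ∙ x).
Proof.
apply/eqP; rewrite -addr_eq0; apply/eqP.
by have := liexx (x + y); rewrite lieDl !lieDr !liexx add0r addr0.
Qed.

Lemma lieA x y z : (x ∙ y) ∙ z = x ∙ y ∙ z - y ∙ x ∙ z.
Proof.
have := lie_jacobi x y z; rewrite [z ∙ (x ∙ y)]lieC [z ∙ x]lieC lieNr => /eqP.
by rewrite subr_eq0 => /eqP <-.
Qed.

Lemma lieL x y z : x ∙ y ∙ z = (x ∙ y) ∙ z + y ∙ x ∙ z.
Proof. by rewrite lieA subrK. Qed.

Lemma lie_adl2 x y z :
  (x ∙ x ∙ y) ∙ z = x ∙ x ∙ y ∙ z - x ∙ y ∙ x ∙ z *+ 2 + y ∙ x ∙ x ∙ z.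
Proof.
rewrite !lieA lieDr lieNr opprB mulr2n opprD !addrA.
by rewrite [_ + _ - x ∙ y ∙ x ∙ z]addrAC.
Qed.

Lemma lie_sumr (I : Type) (s : seq I) (P : pred I) (F : I -> L) x :
  x ∙ (\sum_(i <- s | P i) F i) = \sum_(i <- s | P i) x ∙ F i.
Proof. by apply: (big_morph _ (fun u v => lieDr u v x)); apply: lie0r. Qed.

Lemma lie_suml (I : Type) (s : seq I) (P : pred I) (F : I -> L) x :
  (\sum_(i <- s | P i) F i) ∙ x = \sum_(i <- s | P i) F i ∙ x.
Proof. by apply: (big_morph _ (fun u v => lieDl u v x)); apply: lie0l. Qed.

End LieBasics.

(** Eigenvectors for distinct eigenvalue functions are independent.  If some
    index [j <> i] occurs, an [op o] that separates the two kills the component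
    at [j] after subtracting [ev j o], while it only rescales the one at [i]. *)
Lemma weight_separation (K : fieldType) (L : lieAlgType K) (I : eqType) (O : Type)
    (op : O -> L) (ev : I -> O -> K) (s : seq (I * L)) :
    (forall i j, i <> j -> exists o, ev i o <> ev j o) ->
    (forall p, p \in s -> forall o, op o ∙ p.2 = ev p.1 o *: p.2) ->
  \sum_(p <- s) p.2 = 0 -> forall i, \sum_(p <- s | p.1 == i) p.2 = 0.
Proof.
move=> sep; have [n] := ubnP (size s); elim: n s => // n IHn s ltn hs s0 i.
have [/hasP[p0 p0s p0i]|] := boolP (has (fun p => p.1 != i) s); last first.
  move=> /hasPn all_i; apply: etrans s0; rewrite [RHS](bigID (fun p => p.1 == i)) /=.
  rewrite [X in _ + X]big_seq_cond [X in _ + X]big1 ?addr0 // => p /andP[ps].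
  by rewrite (negbTE (all_i p ps)).
set j := p0.1 in p0i.
have [o /eqP ij] : exists o, ev i o <> ev j o by apply/sep/eqP; rewrite eq_sym.
pose t := [seq (p.1, (ev p.1 o - ev j o) *: p.2) | p <- s & p.1 != j].
have szt : (size t < n)%N.
  rewrite ltnS in ltn; rewrite size_map size_filter; apply: leq_trans ltn.
  rewrite -(count_predC (fun p => p.1 == j) s) -[X in (X < _)%N]add0n ltn_add2r.
  by rewrite -has_count; apply/hasP; exists p0.
have sumt (P : pred I) : \sum_(p <- t | P p.1) p.2 =
    \sum_(p <- s | P p.1) (ev p.1 o - ev j o) *: p.2.
  rewrite big_map big_filter_cond [RHS](bigID (fun p => p.1 == j)) /=.
  rewrite [X in _ = X + _]big1 ?add0r => [|p /andP[_ /eqP ->]]; last first.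
    by rewrite subrr scale0r.
  by apply: eq_bigl => p; rewrite andbC.
have t_ev p : p \in t -> forall o', op o' ∙ p.2 = ev p.1 o' *: p.2.
  move=> /mapP[q]; rewrite mem_filter => /andP[_ qs] -> o' /=.
  by rewrite lieZr hs // !scalerA mulrC.
have t0 : \sum_(p <- t) p.2 = 0.
  rewrite (sumt predT) /=.
  transitivity (op o ∙ (\sum_(p <- s) p.2) - ev j o *: (\sum_(p <- s) p.2)); last first.
    by rewrite s0 lie0r scaler0 subr0.
  rewrite lie_sumr scaler_sumr -sumrB big_seq [RHS]big_seq; apply: eq_bigr => p ps.
  by rewrite scalerBl hs.
have := IHn t szt t_ev t0 i; rewrite (sumt (pred1 i)) /=.
under eq_bigr => p /eqP -> do [].
rewrite -scaler_sumr => /eqP; rewrite scaler_eq0 subr_eq0 (negbTE ij) /= => /eqP.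
exact.
Qed.

Section Span.
Context {K : pzRingType} {M : lmodType K}.
Implicit Types (A : set M) (x y : M).

Lemma lspan_gen A x : A x -> lspan A x.
Proof.
move=> Ax; exists 1%N, (fun _ => 1), (fun _ => x); split=> //.
by rewrite big_ord1 scale1r.
Qed.

Lemma lspan0 A : lspan A 0.
Proof.
by exists 0%N, (fun _ => 0), (fun _ => 0); split; [case | rewrite big_ord0].
Qed.

Lemma lspan_linear A a x y : lspan A x -> lspan A y -> lspan A (a *: x + y).
Proof.
move=> [m [c [u [hu ->]]]] [n [d [v [hv ->]]]].
exists (m + n)%N, (fun i => match fintype.split i with inl j => a * c j | inr j => d j end),
  (fun i => match fintype.split i with inl j => u j | inr j => v j end); split.
  by move=> i; case: (fintype.split i).
rewrite big_split_ord scaler_sumr /=; congr (_ + _); apply: eq_bigr => i _.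
  by rewrite (unsplitK (inl i)) scalerA.
by rewrite (unsplitK (inr i)).
Qed.

Lemma lspan_sum A n (F : 'I_n -> M) : (forall i, lspan A (F i)) -> lspan A (\sum_(i < n) F i).
Proof.
move=> hF; apply: (big_ind (lspan A)) => //; first exact: lspan0.
by move=> x y hx hy; rewrite -[x]scale1r; apply: lspan_linear.
Qed.

Lemma lspan_sub A B : A `<=` lspan B -> lspan A `<=` lspan B.
Proof.
move=> AB x [n [c [a [ha ->]]]]; apply: lspan_sum => i.
by rewrite -[_ *: _]addr0; apply: lspan_linear (lspan0 _); apply: AB.
Qed.

End Span.

(** * Three sl2-triples with a common weight *)

Variant ord3_spec : 'I_3 -> Type :=
  | Ord3_0 : ord3_spec 0 | Ord3_1 : ord3_spec 1 | Ord3_2 : ord3_spec 2.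

Lemma ord3P i : ord3_spec i.
Proof.
by case: i => [[|[|[|//]]] lti]; [have -> : Ordinal lti = 0 by apply/val_inj
  | have -> : Ordinal lti = 1 by apply/val_inj
  | have -> : Ordinal lti = 2 by apply/val_inj]; constructor.
Qed.

Section Zit.
Context {T : Type}.
Variables (f g : T -> T).

(** Iteration with exponent in the integers, [g] playing the inverse of [f]. *)
Definition iterz (n : int) (z : T) : T :=
  match n with Posz k => iter k f z | Negz k => iter k.+1 g z end.

Variable P : T -> Prop.
Hypotheses (Pf : forall z, P z -> P (f z)) (Pg : forall z, P z -> P (g z)).
Hypotheses (fK : forall z, P z -> f (g z) = z) (gK : forall z, P z -> g (f z) = z).

Lemma iterz_in n z : P z -> P (iterz n z).
Proof.
by move=> Pz; case: n => k; [|apply: Pg]; elim: k => //= k; [apply: Pf|apply: Pg].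
Qed.

Lemma iterzS n z : P z -> f (iterz n z) = iterz (n + 1) z.
Proof.
move=> Pz; case: n => [k|[|k]].
- by have -> : Posz k + 1 = Posz k.+1 by lia.
- by rewrite /= fK.
have -> : Negz k.+1 + 1 = Negz k by lia.
by rewrite fK //; apply: (iterz_in (Negz k)).
Qed.

Lemma iterzP n z : P z -> g (iterz n z) = iterz (n - 1) z.
Proof.
move=> Pz; have -> : n = n - 1 + 1 by rewrite subrK.
by rewrite -iterzS // gK ?addrK //; apply: iterz_in.
Qed.

Lemma iterz_comm (h : T -> T) : (forall z, P z -> P (h z)) ->
    (forall z, P z -> h (f z) = f (h z)) -> (forall z, P z -> h (g z) = g (h z)) ->
  forall n z, P z -> h (iterz n z) = iterz n (h z).
Proof.
move=> Ph hf hg [] k z Pz.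
  by elim: k => //= k <-; rewrite hf //; apply: (iterz_in (Posz k)).
elim: k => [|k /= IHk]; first exact: hg.
by rewrite -IHk hg //; apply: (iterz_in (Negz k)).
Qed.

End Zit.

Section Level.
Context {K : numFieldType} {L : lieAlgType K}.
Implicit Types (x y : 'I_3 -> L) (u v w : L) (i j k : 'I_3).

Definition level x y (n : int) : set L :=
  [set v | forall i, (x i ∙ y i) ∙ v = n%:~R *: v].

(** What the bound on the root spaces uses of the presented algebra.  The
    semisimple elements of the three sl2-triples act alike, and [[x i, y j]] kills
    the third [x k], the weight of the bracket not being a root. *)
Record triples x y : Prop := Triples {
  level_pos : forall i, level x y 2 (x i);
  level_neg : forall i, level x y (- 2) (y i);
  level_pos4 : forall v, level x y 4 v -> v = 0;
  level_neg4 : forall v, level x y (- 4) v -> v = 0;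
  triple_pos : forall i j k, uniq [:: i; j; k] -> (x i ∙ y j) ∙ x k = 0;
  triple_neg : forall i j k, uniq [:: i; j; k] -> (y i ∙ x j) ∙ y k = 0 }.

Lemma level_swap x y n v : level x y n v <-> level y x (- n) v.
Proof.
split=> lv i; rewrite [X in X ∙ v]lieC lieNl lv mulrNz scaleNr //.
by rewrite opprK.
Qed.

Lemma triples_swap x y : triples x y -> triples y x.
Proof.
move=> [lp ln l4 l4' tp tn]; split=> // [i|i|v|v].
- exact/(level_swap y x 2).
- by apply/(level_swap y x (- 2)).
- by move=> /level_swap; apply: l4'.
- by move=> /level_swap; rewrite opprK; apply: l4.
Qed.

Lemma levelZ x y n a v : level x y n v -> level x y n (a *: v).
Proof. by move=> lv i; rewrite lieZr lv !scalerA mulrC. Qed.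

Lemma level_lie x y m n u v :
  level x y m u -> level x y n v -> level x y (m + n) (u ∙ v).
Proof.
by move=> lu lv i; rewrite lieL lu lv lieZl lieZr -scalerDl intrD.
Qed.

End Level.

HB.lock Definition quad (K : numFieldType) (L : lieAlgType K) (x : 'I_3 -> L)
  (i : 'I_3) (u : L) : L := 2^-1 *: (x i ∙ x i ∙ u).

Section Triples.
Context {K : numFieldType} {L : lieAlgType K}.
Implicit Types (x y : 'I_3 -> L) (u v w : L) (i j k : 'I_3).

Lemma quadE x i u : quad x i u = 2^-1 *: (x i ∙ x i ∙ u).
Proof. by rewrite quad.unlock. Qed.

Lemma quadZ x i a u : quad x i (a *: u) = a *: quad x i u.
Proof. by rewrite !quadE !lieZr !scalerA mulrC. Qed.

Lemma cancel3 u v : - (u + u) + v = u - (v + v) -> v = u.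
Proof.
move=> E; apply: (@scalerI _ _ (1 + 1 + 1 : K)).
  by have -> : 1 + 1 + 1 = 3%:R :> K; [ring | rewrite pnatr_eq0].
rewrite !scalerDl !scale1r; apply: (addrI (- (u + u) - (v + v))).
by rewrite -addrA addKr E [- (u + u) - _]addrC -[RHS]addrA addKr addrC.
Qed.

Lemma quadN x i u : quad x i (- u) = - quad x i u.
Proof. by rewrite -scaleN1r quadZ scaleN1r. Qed.

Section OneSide.
Variables x y : 'I_3 -> L.
Hypothesis xy : triples x y.
Local Notation lv := (level x y).
Local Notation D i j := (lie (x i ∙ y j)).

Lemma lev_x i : lv 2 (x i). Proof. exact: level_pos. Qed.
Lemma lev_y i : lv (- 2) (y i). Proof. exact: level_neg. Qed.

Lemma lev_D i j n v : lv n v -> lv n (D i j v).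
Proof.
move=> nv; have := level_lie (level_lie (lev_x i) (lev_y j)) nv.
by rewrite subrr add0r.
Qed.

Lemma lev_quad i u : lv (- 2) u -> lv 2 (quad x i u).
Proof.
move=> nu; rewrite quadE; apply: levelZ; exact: level_lie (lev_x i) (level_lie (lev_x i) nu).
Qed.

Lemma raise_top i v : lv 2 v -> x i ∙ v = 0.
Proof. by move=> nv; apply: (level_pos4 xy); apply: (level_lie (lev_x i) nv). Qed.

Lemma lie_top u v : lv 2 u -> lv 2 v -> u ∙ v = 0.
Proof. by move=> nu nv; apply: (level_pos4 xy); apply: (level_lie nu nv). Qed.

Lemma D_top i j v : lv 2 v -> D i j v = x i ∙ y j ∙ v.
Proof. by move=> nv; rewrite lieA (raise_top i nv) lie0r subr0. Qed.

Lemma Dii i v : lv 2 v -> D i i v = 2 *: v.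
Proof. by move=> /(_ i). Qed.

Lemma Dj i j : i != j -> D i j (x j) = 2 *: x i.
Proof.
move=> ij; rewrite D_top ?[y j ∙ _]lieC ?lieNr; last exact: lev_x.
by rewrite lieC opprK (lev_x i).
Qed.

Lemma Dk i j k : uniq [:: i; j; k] -> D i j (x k) = 0.
Proof. exact: triple_pos. Qed.

End OneSide.

(** The sl2-relations at highest weight 2: [(ad y)^2 / 2] sends a highest weight
    vector to a lowest weight vector, and [(ad x)^2 / 2] brings it back. *)
Lemma quadK x y i v : triples x y -> level x y 2 v -> quad x i (quad y i v) = v.
Proof.
move=> xy nv; rewrite !quadE !lieZr scalerA.
rewrite [x i ∙ y i ∙ _]lieL [x i ∙ y i ∙ v]lieL (raise_top xy i nv) lie0r addr0.
rewrite (nv i) !lieZr (level_lie (lev_y xy i) nv i) addNr scale0r add0r !lieZr.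
rewrite -(D_top xy) // (nv i) !scalerA -invfM -natrM.
by rewrite mulVf ?scale1r ?pnatr_eq0.
Qed.

Section Semicommutation.
Variables x y : 'I_3 -> L.
Hypothesis xy : triples x y.
Let yx := triples_swap xy.
Local Notation lv := (level x y).
Local Notation D i j := (lie (x i ∙ y j)).

Lemma lev_quady i u : lv 2 u -> lv (- 2) (quad y i u).
Proof. by move=> /level_swap/(lev_quad yx i)/level_swap. Qed.

Lemma quadyK i u : lv (- 2) u -> quad y i (quad x i u) = u.
Proof. by move=> /level_swap; apply: quadK. Qed.

Lemma lower_bottom i u : lv (- 2) u -> y i ∙ u = 0.
Proof. by move=> /level_swap; apply: (raise_top yx). Qed.

Lemma Dswap i j v : D i j v = - ((y j ∙ x i) ∙ v).
Proof. by rewrite -lieNl -lieC. Qed.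

Lemma D_bottom i j u : lv (- 2) u -> D i j u = - (y j ∙ x i ∙ u).
Proof. by move=> /level_swap nu; rewrite Dswap (D_top yx). Qed.

(** The third power of [ad (x i)] kills level -2, so that, with
    [X = ad (x i)], [Y = ad (y j)] and [z = [x i, [x i, y j]]], the relation
    [X (ad z) = (ad z) X] becomes [X Y X^2 = X^2 Y X] there. *)
Lemma D_quad i j u : lv (- 2) u -> D i j (quad x i u) = - quad x i (D i j u).
Proof.
move=> nu; have n0 := level_lie (lev_x xy i) nu.
have n2 := level_lie (lev_x xy i) n0.
have nz := level_lie (lev_x xy i) (level_lie (lev_x xy i) (lev_y xy j)).
rewrite !quadE lieZr (D_top xy) // (D_bottom i j nu) !lieNr scalerN opprK.
congr (_ *: _).
have := lieL (x i) (x i ∙ x i ∙ y j) u.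
rewrite (lie_top xy (lev_x xy i) nz) lie0l add0r => E.
have z3 : x i ∙ x i ∙ x i ∙ u = 0 by rewrite (raise_top xy).
have y0 : y j ∙ u = 0 by rewrite lower_bottom.
move: E; rewrite !lie_adl2 z3 y0 !lie0r add0r addr0 lieDr lieNr !mulr2n => E.
move: E; rewrite lieDr; exact: cancel3.
Qed.

End Semicommutation.

Section Commutation.
Variables x y : 'I_3 -> L.
Hypothesis xy : triples x y.
Let yx := triples_swap xy.
Local Notation lv := (level x y).
Local Notation D i j := (lie (x i ∙ y j)).

Lemma D_quady i j v : lv 2 v -> D i j (quad y j v) = - quad y j (D i j v).
Proof.
move=> /level_swap nv; rewrite !(Dswap x y i j) (D_quad yx) //.
by rewrite quadN.
Qed.

(** [D_quady] transported by [quad x j], the inverse of [quad y j]. *)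
Lemma D_quad' i j u : lv (- 2) u -> D i j (quad x j u) = - quad x j (D i j u).
Proof.
move=> nu; have nv := lev_quad xy j nu.
have /(congr1 (quad x j)) := D_quady i j nv.
rewrite quadyK // => ->.
by rewrite quadN quadK ?opprK //; apply: lev_D.
Qed.

Lemma D_quadk i j k u : uniq [:: i; j; k] -> D i j (quad x k u) = quad x k (D i j u).
Proof.
move=> ijk; rewrite !quadE lieZr; congr (_ *: _).
by rewrite lieL Dk // lie0l add0r [D i j (x k ∙ u)]lieL Dk // lie0l add0r.
Qed.

Definition sgn_at i j k : K := (-1) ^+ ((k == i) || (k == j)).

Lemma D_quadE i j k u : i != j -> lv (- 2) u ->
  D i j (quad x k u) = sgn_at i j k *: quad x k (D i j u).
Proof.
rewrite /sgn_at => ij nu.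
have [->|ki] := eqVneq k i; first by rewrite scaleN1r D_quad.
have [->|kj] := eqVneq k j; first by rewrite scaleN1r D_quad'.
by rewrite scale1r D_quadk //= !inE negb_or ij !(eq_sym _ k) ki kj.
Qed.

(** [D j k (quad x k u)] computed in two ways: by the Leibniz rule, with
    [D j k (x k) = 2 x j], and by [D_quad'].  It reduces all double raisings to
    a single [quad]. *)
Lemma lie_lie_bottom j k u : j != k -> lv (- 2) u ->
  x j ∙ x k ∙ u = - quad x k (D j k u).
Proof.
move=> jk nu; have xjk : x k ∙ x j ∙ u = x j ∙ x k ∙ u.
  by rewrite lieL (lie_top xy (lev_x xy k) (lev_x xy j)) lie0l add0r.
have : D j k (quad x k u) = 2 *: (x j ∙ x k ∙ u) + quad x k (D j k u).
  rewrite !quadE lieZr lieL [D j k (x k ∙ u)]lieL (Dj xy jk).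
  rewrite !lieDr !lieZl !lieZr xjk addrA -scalerDl scalerDr scalerA.
  by congr (_ *: _ + _); rewrite mulrDr mulVf ?pnatr_eq0 // -natrD.
rewrite D_quad' // => /eqP; rewrite -subr_eq -opprD -mulr2n -scaler_nat -scalerN.
by move=> /eqP/scalerI ->//; rewrite pnatr_eq0.
Qed.

End Commutation.

Section Shifts.
Variables x y : 'I_3 -> L.
Hypothesis xy : triples x y.
Let yx := triples_swap xy.
Local Notation lv := (level x y).
Local Notation D i j := (lie (x i ∙ y j)).

Definition shift i j v := quad x i (quad y j v).

Lemma lev_shift i j v : lv 2 v -> lv 2 (shift i j v).
Proof. by move=> nv; apply: (lev_quad xy); apply: (lev_quady xy). Qed.

Lemma shiftZ i j a v : shift i j (a *: v) = a *: shift i j v.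
Proof. by rewrite /shift !quadZ. Qed.

Lemma shift_comp i j k v : lv 2 v -> shift i j (shift j k v) = shift i k v.
Proof. by move=> nv; rewrite /shift (quadyK xy) //; apply: (lev_quady xy). Qed.

Lemma shift_id i v : lv 2 v -> shift i i v = v.
Proof. exact: quadK. Qed.

Lemma shiftK i j v : lv 2 v -> shift i j (shift j i v) = v.
Proof. by move=> nv; rewrite shift_comp // shift_id. Qed.

Lemma quady_self i : quad y i (x i) = - y i.
Proof.
rewrite !quadE [y i ∙ x i]lieC lieNr [y i ∙ (x i ∙ _)]lieC opprK.
by rewrite (lev_y xy i i) scalerA mulrNz mulrN mulVf ?scaleN1r // pnatr_eq0.
Qed.

Lemma Di i j : D i j (x i) = 2 *: shift i j (x j).
Proof.
by rewrite /shift quady_self quadN quadE scalerN scalerA divff ?pnatr_eq0 // scale1r -lieC.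
Qed.

Lemma quady_sgn i j k v : i != j -> lv 2 v ->
  D i j (quad y k v) = sgn_at i j k *: quad y k (D i j v).
Proof.
move=> ij /level_swap nv; rewrite !(Dswap x y i j) (D_quadE yx) //; last by rewrite eq_sym.
by rewrite quadN scalerN /sgn_at orbC.
Qed.

Lemma D_shift i j k l v : i != j -> lv 2 v ->
  D i j (shift k l v) = (sgn_at i j k * sgn_at i j l) *: shift k l (D i j v).
Proof.
move=> ij nv; rewrite /shift (D_quadE xy) ?quady_sgn //; last exact: (lev_quady xy).
by rewrite quadZ scalerA.
Qed.

Lemma sgn_atK i j k : sgn_at i j k * sgn_at i j k = 1.
Proof. by rewrite /sgn_at -expr2 sqrr_sign. Qed.

Lemma shift_D i j k l v : i != j -> lv 2 v ->
  shift k l (D i j v) = (sgn_at i j k * sgn_at i j l) *: D i j (shift k l v).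
Proof.
by move=> ij nv; rewrite D_shift // scalerA mulrACA !sgn_atK mulr1 scale1r.
Qed.

(** Jordan-theoretically, the square of a multiplication operator in terms of
    the quadratic operator; the second term is symmetric in [shift i j (x j)] and
    [v], which is what [shift_comm_base] exploits. *)
Lemma D_sqr i j v : lv 2 v ->
  D i j (D i j v) = 2 *: shift i j v + shift i j (x j) ∙ y j ∙ v.
Proof.
move=> nv.
have lDv := lev_D xy i j nv.
have top : x i ∙ x i ∙ y j ∙ v = 0 by rewrite -(D_top xy) // (raise_top xy).
rewrite /shift quady_self quadN !quadE lieNl lieZl lie_adl2 top lie0r addr0.
rewrite (D_top xy) // (D_top xy) // !lieZr scalerDr opprD scalerN opprK.
rewrite !scalerA divff ?pnatr_eq0 // mul1r addrA subrr add0r.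
by rewrite -scaler_nat scalerA mulVf ?scale1r ?pnatr_eq0.
Qed.

Lemma D_sqr_x i j : i != j -> D i j (D i j (x j)) = 4 *: shift i j (x j).
Proof. by move=> ij; rewrite (Dj xy ij) lieZr Di scalerA -natrM. Qed.

(** Let [a] and [b] be the two sides.  By [D_sqr] and the (semi)commutation of
    [D i 0] with shifts, [4 a = 2 b + g] and [4 b = 2 a + g'].  Here [g = g'],
    because [shift i 0 (x 0)] and [shift j 0 (x 0)] commute, so [6 (a - b) = 0]. *)
Lemma shift_comm_base i j : i != 0 -> j != 0 -> i != j ->
  shift i 0 (shift j 0 (x 0)) = shift j 0 (shift i 0 (x 0)).
Proof.
have half k l : k != 0 -> l != 0 ->
    4 *: shift k 0 (shift l 0 (x 0)) = 2 *: shift l 0 (shift k 0 (x 0)) +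
      shift l 0 (x 0) ∙ y 0 ∙ shift k 0 (x 0).
  move=> k0 l0; have lx0 := lev_x xy 0.
  rewrite -D_sqr; last exact: lev_shift.
  rewrite -shiftZ -D_sqr_x // [D l 0 (shift k 0 _)]D_shift // lieZr.
  rewrite D_shift //; last exact: (lev_D xy).
  by rewrite scalerA mulrACA !sgn_atK mulr1 scale1r.
move=> i0 j0 ij; have := half i j i0 j0; have := half j i j0 i0.
set a := shift i 0 (shift j 0 _); set b := shift j 0 (shift i 0 _).
have -> : shift i 0 (x 0) ∙ y 0 ∙ shift j 0 (x 0) =
    shift j 0 (x 0) ∙ y 0 ∙ shift i 0 (x 0).
  rewrite lieL (lie_top xy (lev_shift i 0 (lev_x xy 0)) (lev_shift j 0 (lev_x xy 0))).
  by rewrite lie0r addr0 lieC -lieNr -lieC.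
set g := shift j 0 _ ∙ _ => Eb Ea; apply: (@scalerI _ _ (4 + 2 : K)).
  by rewrite -natrD pnatr_eq0.
by rewrite 2!(scalerDl _ 4 2) Ea Eb addrAC [2 *: b + _]addrC addrAC.
Qed.


(** On these vectors an identity between shifts only has to be checked at [x 0],
    since each [D i j] commutes with each shift up to a sign. *)
Inductive word : L -> Prop :=
  | Word0 : word (x 0)
  | WordD i j v : i != j -> word v -> word (D i j v)
  | WordZ a v : word v -> word (a *: v).

Lemma lev_word v : word v -> lv 2 v.
Proof.
elim=> [|i j {}v _ _|a {}v _]; first exact: lev_x.
  exact: lev_D.
exact: levelZ.
Qed.

Lemma word_x i : word (x i).
Proof.
have [->|i0] := eqVneq i 0; first exact: Word0.
suff -> : x i = 2^-1 *: D i 0 (x 0) by apply/WordZ/WordD => //; apply: Word0.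
by rewrite (Dj xy) // scalerA mulVf ?scale1r ?pnatr_eq0.
Qed.

Lemma shift_x0 k l : k != l -> (k == 0) || (l == 0) ->
  shift k l (x 0) = 4^-1 *: D k l (D k l (x 0)).
Proof.
move=> kl /orP[]/eqP E0; move: kl; rewrite E0 => kl.
  have e : x 0 = 2^-1 *: D 0 l (x l).
    by rewrite (Dj xy kl) scalerA mulVf ?scale1r ?pnatr_eq0.
  rewrite [in LHS]e shiftZ.
  have := D_shift 0 l kl (lev_x xy l).
  rewrite /sgn_at !eqxx orbT /= mulrNN mulr1 scale1r => <-.
  by rewrite [D 0 l (x 0)]Di lieZr scalerA; congr (_ *: _); field.
by rewrite D_sqr_x // scalerA mulVf ?scale1r ?pnatr_eq0.
Qed.

Lemma word_shift k l v : (k == 0) || (l == 0) -> word v -> word (shift k l v).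
Proof.
move=> kl0; have [->|kl] := eqVneq k l.
  by move=> wv; rewrite shift_id //; apply: lev_word.
elim=> [|i j {}v ij wv IHv|a {}v wv IHv].
- by rewrite shift_x0 //; do ![apply: WordZ | apply: WordD => //]; apply: Word0.
- by rewrite shift_D //; [apply/WordZ/WordD | apply: lev_word].
- by rewrite shiftZ; apply: WordZ.
Qed.

Lemma shift_comm v : word v ->
  shift 1 0 (shift 2 0 v) = shift 2 0 (shift 1 0 v).
Proof.
elim=> [|i j {}v ij wv IHv|a {}v wv IHv].
- exact: shift_comm_base.
- have nv := lev_word wv.
  have ns k l : lv 2 (shift k l v) by apply: lev_shift.
  rewrite !(shift_D _ _ ij nv) !shiftZ !(shift_D _ _ ij (ns _ _)) IHv.
  by rewrite !scalerA [X in X *: _]mulrC.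
- by rewrite !shiftZ IHv.
Qed.

Lemma shift_comm' v : word v ->
  shift 1 0 (shift 0 2 v) = shift 0 2 (shift 1 0 v).
Proof.
move=> wv; have w' : word (shift 0 2 v) by apply: word_shift.
rewrite -[in RHS](shiftK 2 0 (lev_word wv)) shift_comm // shiftK //.
by apply/lev_word/word_shift.
Qed.

Definition vec p (a b : int) : L :=
  iterz (shift 1 0) (shift 0 1) a (iterz (shift 2 0) (shift 0 2) b (x p)).

Lemma word_iterz k (n : int) v :
  word v -> word (iterz (shift k 0) (shift 0 k) n v).
Proof.
by apply: iterz_in => z; apply: word_shift; rewrite eqxx ?orbT.
Qed.

Lemma word_vec p a b : word (vec p a b).
Proof. by do 2!apply: word_iterz; apply: word_x. Qed.

Lemma lev_vec p a b : lv 2 (vec p a b). Proof. exact/lev_word/word_vec. Qed.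

Lemma iterz_shiftS k n v : word v -> 
  shift k 0 (iterz (shift k 0) (shift 0 k) n v) =
  iterz (shift k 0) (shift 0 k) (n + 1) v.
Proof.
move=> wv; apply: (iterzS (P := word)) => // z wz;
  by [apply: word_shift; rewrite ?eqxx ?orbT | apply/shiftK/lev_word].
Qed.

Lemma iterz_shiftP k n v : word v -> 
  shift 0 k (iterz (shift k 0) (shift 0 k) n v) =
  iterz (shift k 0) (shift 0 k) (n - 1) v.
Proof.
move=> wv; apply: (iterzP (P := word)) => // z wz;
  by [apply: word_shift; rewrite ?eqxx ?orbT | apply/shiftK/lev_word].
Qed.

Lemma shift10_vec p a b : shift 1 0 (vec p a b) = vec p (a + 1) b.
Proof. by apply: iterz_shiftS; apply/word_iterz/word_x. Qed.

Lemma shift01_vec p a b : shift 0 1 (vec p a b) = vec p (a - 1) b.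
Proof. by apply: iterz_shiftP; apply/word_iterz/word_x. Qed.

Lemma shift_iterz k l n v : (k == 0) || (l == 0) -> word v ->
    (forall z, word z -> shift k l (shift 1 0 z) = shift 1 0 (shift k l z)) ->
  shift k l (iterz (shift 1 0) (shift 0 1) n v) =
  iterz (shift 1 0) (shift 0 1) n (shift k l v).
Proof.
move=> kl0 wv c; apply: (iterz_comm (P := word)) => // z wz; try exact: word_shift.
have w' : word (shift 0 1 z) by apply: word_shift.
rewrite -[in RHS](shiftK 1 0 (lev_word wz)) c // shiftK //.
by apply/lev_word/word_shift.
Qed.

Lemma shift20_vec p a b : shift 2 0 (vec p a b) = vec p a (b + 1).
Proof.
rewrite /vec -(iterz_shiftS _ _ (word_x p)) shift_iterz //.
  exact/word_iterz/word_x.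
by move=> z wz; rewrite shift_comm.
Qed.

Lemma shift02_vec p a b : shift 0 2 (vec p a b) = vec p a (b - 1).
Proof.
rewrite /vec -(iterz_shiftP _ _ (word_x p)) shift_iterz //.
  exact/word_iterz/word_x.
by move=> z wz; rewrite shift_comm'.
Qed.

Definition line v := exists p a b c, v = c *: vec p a b.

Lemma line_vec p a b : line (vec p a b).
Proof. by exists p, a, b, 1; rewrite scale1r. Qed.

Lemma lineZ c v : line v -> line (c *: v).
Proof. by move=> [p [a [b [d ->]]]]; rewrite scalerA; exists p, a, b, (c * d). Qed.

Lemma lineN v : line v -> line (- v).
Proof. by rewrite -scaleN1r; apply: lineZ. Qed.

Lemma line0 : line 0.
Proof. by rewrite -(scale0r (vec 0 0 0)); apply/lineZ/line_vec. Qed.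

Lemma line_word v : line v -> word v.
Proof. by move=> [p [a [b [c ->]]]]; apply/WordZ/word_vec. Qed.

Lemma lev_line v : line v -> lv 2 v.
Proof. by move/line_word/lev_word. Qed.

Lemma line_shift k l v : line v -> line (shift k l v).
Proof.
move=> Lv; have shift0 i w : line w -> line (shift i 0 w).
  move=> [p [a [b [c ->]]]]; rewrite shiftZ; apply: lineZ.
  case: (ord3P i); rewrite ?shift10_vec ?shift20_vec; try exact: line_vec.
  by rewrite shift_id; [exact: line_vec | exact: lev_vec].
have shift0' i w : line w -> line (shift 0 i w).
  move=> [p [a [b [c ->]]]]; rewrite shiftZ; apply: lineZ.
  case: (ord3P i); rewrite ?shift01_vec ?shift02_vec; try exact: line_vec.
  by rewrite shift_id; [exact: line_vec | exact: lev_vec].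
rewrite -(shift_comp k 0 l (lev_line Lv)).
by apply/shift0/shift0'.
Qed.

Lemma line_iterz k n v : line v -> line (iterz (shift k 0) (shift 0 k) n v).
Proof. by apply: iterz_in => z; apply: line_shift. Qed.

Lemma D_iter i j k l m v : i != j -> (k == 0) || (l == 0) -> word v ->
  exists c, D i j (iter m (shift k l) v) = c *: iter m (shift k l) (D i j v).
Proof.
move=> ij kl wv; elim: m => [|m [c IHm]] /=; first by exists 1; rewrite scale1r.
have wm : word (iter m (shift k l) v).
  by elim: m {IHm} => //= m; apply: word_shift.
by rewrite D_shift ?IHm ?shiftZ ?scalerA; [eexists | | apply: lev_word].
Qed.

(** [D i j] moves past the shifts up to sign, and on [x p] it is zero, [2 x i] or
    [2 shift i j (x j)]: no sums ever appear.  This is why root spaces are lines. *)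
Lemma line_D i j v : line v -> line (D i j v).
Proof.
have [->|ij Lv] := eqVneq i j.
  by move=> Lv; rewrite Dii; [apply: lineZ | apply: lev_line].
have Dx p : line (D i j (x p)).
  have [->|pj] := eqVneq p j.
    by rewrite (Dj xy ij); apply/lineZ/(line_vec i 0 0).
  have [->|pi] := eqVneq p i.
    by rewrite Di; apply/lineZ/line_shift/(line_vec j 0 0).
  rewrite (Dk xy); first exact: line0.
  by rewrite /= !inE negb_or ij !(eq_sym _ p) pi pj.
have Dz k n w : word w -> line (D i j w) ->
    line (D i j (iterz (shift k 0) (shift 0 k) n w)).
  move=> ww Lw; have Lz := line_iterz k n Lw.
  have [c Dc] : exists c, D i j (iterz (shift k 0) (shift 0 k) n w) =
      c *: iterz (shift k 0) (shift 0 k) n (D i j w).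
    by case: {Lz} n => m; apply: D_iter => //; rewrite eqxx ?orbT.
  by rewrite Dc; apply: lineZ.
move: Lv => [p [a [b [c ->]]]]; rewrite lieZr; apply: lineZ.
apply: (Dz) (word_iterz _ _ (word_x p)) _.
by apply: (Dz) (word_x p) (Dx p).
Qed.

(** The shape of an iterated bracket of the [x i] and [y i]: one case for each of
    the levels 2 and -2, two for level 0.  At level -2 the vectors are written with
    [y 0] only, as [quad y i v = quad y 0 (shift 0 i v)]. *)
Definition bracket_shape w := exists2 v, line v &
  [\/ w = v, w = quad y 0 v, exists j, w = y j ∙ v
    | exists j, w = x j ∙ quad y 0 v].

Lemma shape_pos v : line v -> bracket_shape v.
Proof. by exists v => //; constructor 1. Qed.

Lemma shape_neg i v : line v -> bracket_shape (quad y i v).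
Proof.
move=> Lv; exists (shift 0 i v); first exact: line_shift.
by constructor 2; rewrite /shift (quadyK xy) //; apply/lev_quady/lev_line.
Qed.

Lemma shape0 : bracket_shape 0.
Proof. exact: (shape_pos line0). Qed.

Lemma shape_x i : bracket_shape (x i).
Proof. exact: (shape_pos (line_vec i 0 0)). Qed.

Lemma shape_y i : bracket_shape (y i).
Proof.
rewrite -[y i]opprK -quady_self -quadN; apply: shape_neg.
by rewrite -scaleN1r; apply: lineZ (line_vec i 0 0).
Qed.

Lemma shape_lie_x i w : bracket_shape w -> bracket_shape (x i ∙ w).
Proof.
move=> [v Lv [->|->|[j ->]|[j ->]]].
- by rewrite (raise_top xy); [exact: shape0 | exact: lev_line].
- by exists v => //; constructor 4; exists i.
- by rewrite -(D_top xy); [apply/shape_pos/line_D | apply: lev_line].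
- apply: shape_pos; have nu := lev_quady xy 0 (lev_line Lv).
  have [->|ij] := eqVneq i j.
    rewrite -[x j ∙ _](scale1r) -(divff (_ : 2 != 0)) ?pnatr_eq0 //.
    by rewrite -scalerA -quadE; apply/lineZ/(line_shift j 0).
  rewrite (lie_lie_bottom xy ij nu) quady_sgn //; last exact: lev_line.
  rewrite quadZ -scalerN -scaleN1r; do 2!apply: lineZ.
  by apply/(line_shift j 0)/line_D.
Qed.

Lemma shape_lie_y i w : bracket_shape w -> bracket_shape (y i ∙ w).
Proof.
move=> [v Lv [->|->|[j ->]|[j ->]]].
- by exists v => //; constructor 3; exists i.
- rewrite (lower_bottom xy); [exact: shape0 | exact/lev_quady/lev_line].
- have [->|ij] := eqVneq i j.
    rewrite -[y j ∙ _](scale1r) -(divff (_ : 2 != 0)) ?pnatr_eq0 //.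
    by rewrite -scalerA -quadE -quadZ; apply/shape_neg/lineZ.
  have /level_swap nv := lev_line Lv.
  rewrite (lie_lie_bottom yx ij nv) -quadN -lieNl -lieC.
  by apply/shape_neg/line_D.
- rewrite -[_ ∙ _]opprK -(D_bottom xy); last exact/lev_quady/lev_line.
  have [->|ij] := eqVneq i j.
    rewrite (lev_quady xy 0 (lev_line Lv) j) -quadZ -quadN.
    by apply/shape_neg/lineN/lineZ.
  rewrite quady_sgn; [|by rewrite eq_sym|exact: lev_line].
  by rewrite -quadZ -quadN; apply/shape_neg/lineN/lineZ/line_D.
Qed.

Lemma shift_eq0 i j v : lv 2 v -> shift i j v = 0 -> v = 0.
Proof.
by move=> nv z; rewrite -[v](shiftK j i) // z -(scale0r 0) shiftZ !scale0r.
Qed.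

Lemma iterz_eq0 k n v : word v ->
  iterz (shift k 0) (shift 0 k) n v = 0 -> v = 0.
Proof.
have it l m m' : (l == 0) || (m' == 0) -> word v ->
    iter m (shift l m') v = 0 -> v = 0.
  move=> lm wv; have wm n' : word (iter n' (shift l m') v).
    by elim: n' => //= n'; apply: word_shift.
  by elim: m => //= m IHm /shift_eq0 z; apply/IHm/z/lev_word/wm.
by move=> wv; case: n => m; apply: it; rewrite ?eqxx ?orbT.
Qed.

Lemma vec_neq0 p a b : x p != 0 -> vec p a b != 0.
Proof.
apply: contra_neq; rewrite /vec.
by move/(iterz_eq0 (word_iterz _ _ (word_x p)))/(iterz_eq0 (word_x p)).
Qed.

End Shifts.
End Triples.

(** * A Lie algebra over the quantum torus *)

Section FreeModule.
Context {K : nzRingType} {B : choiceType}.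
Local Notation M := {freeg B / K}.
Implicit Types (a : K) (b : B) (u v : M).

Lemma scale_freegU a c b : a *: << c *g b >> = << a * c *g b >> :> M.
Proof.
apply/eqP/freeg_eqP => b'.
by rewrite coeffZ !coeffU mulrA.
Qed.

Section Lift.
Context {N : lmodType K}.
Variable f : B -> N.

Lemma fgliftD u v : fglift f (u + v) = fglift f u + fglift f v.
Proof.
have fB := lift_is_additive f.
have f0 : fglift f 0 = 0 by rewrite -(subrr 0) fB subrr.
by rewrite -[v in LHS]opprK fB -[- v]sub0r fB f0 sub0r opprK.
Qed.

Lemma fglift0 : fglift f 0 = 0.
Proof. by rewrite -(subrr 0) lift_is_additive subrr. Qed.

Lemma fglift_sum (I : Type) (s : seq I) (F : I -> M) :
  fglift f (\sum_(i <- s) F i) = \sum_(i <- s) fglift f (F i).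
Proof. exact: (big_morph _ fgliftD fglift0). Qed.

Lemma fgliftE u : fglift f u = \sum_(b <- dom u) coeff b u *: f b.
Proof.
rewrite -[in LHS](freeg_sumE u) fglift_sum.
by apply: eq_bigr => b _; rewrite liftU.
Qed.

Lemma fglift_linear a u v : fglift f (a *: u + v) = a *: fglift f u + fglift f v.
Proof.
rewrite fgliftD; congr (_ + _); rewrite -[in LHS](freeg_sumE u) scaler_sumr.
rewrite fglift_sum fgliftE scaler_sumr; apply: eq_bigr => b _.
by rewrite scale_freegU liftU scalerA.
Qed.

Lemma fgliftU b : fglift f << b >> = f b.
Proof. by rewrite liftU scale1r. Qed.

End Lift.

Lemma freeg_ext (N : lmodType K) (f : M -> N) :
    (forall a u v, f (a *: u + v) = a *: f u + f v) ->
  (forall b, f << b >> = 0) -> forall u, f u = 0.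
Proof.
move=> lf f0 u.
have f00 : f 0 = 0.
  by apply: (addrI (f 0)); have := lf 1 0 0; rewrite !scale1r !addr0.
rewrite -(freeg_sumE u); elim: (dom u) => [|b s IHs]; first by rewrite big_nil.
by rewrite big_cons -[coeff b u]mulr1 -scale_freegU lf f0 scaler0 add0r.
Qed.

End FreeModule.

Section QuantumTorus.
Context {K : numFieldType}.

(** [((m, n), (i, j))] stands for the monomial [t_1^m t_2^n s^i r^j] of the 2 x 2
    matrices over the quantum torus [t_1 t_2 = - t_2 t_1]; here [s = diag(1, -1)]
    and [r] exchanges the two coordinates, so that [r s = - s r] and
    [s^2 = r^2 = 1]. *)
Definition grid : Type := (int * int) * (bool * bool).
HB.instance Definition _ := Choice.on grid.
Implicit Types (g h k : grid).

Definition addg g h : grid :=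
  (g.1 + h.1, (g.2.1 (+) h.2.1, g.2.2 (+) h.2.2)).

Definition parity (n : int) : bool := odd `|n|%N.

Lemma parityD m n : parity (m + n) = parity m (+) parity n.
Proof. by rewrite /parity; lia. Qed.

Lemma parityN n : parity (- n) = parity n.
Proof. by rewrite /parity abszN. Qed.

Lemma parityE (n : int) : exists p, n = (parity n)%:Z + p + p.
Proof. by exists (n %/ 2)%Z; rewrite /parity; lia. Qed.

Definition twist g h : bool :=
  (parity g.1.2 && parity h.1.1) (+) (g.2.2 && h.2.1).

(** The product of the monomials [g] and [h] is [chi g h] times [addg g h].  All
    computations below rest on [chi] being a bicharacter with values 1 and -1. *)
Definition chi g h : K := (-1) ^+ twist g h.

Lemma chiDr g h k : chi g (addg h k) = chi g h * chi g k.
Proof.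
rewrite /chi -signr_addb /twist /= parityD; congr (_ ^+ _); congr nat_of_bool.
by case: (parity _) (parity _) (parity _) g.2.2 h.2.1 k.2.1 => [] [] [] [] [] [].
Qed.

Lemma chiDl g h k : chi (addg g h) k = chi g k * chi h k.
Proof.
rewrite /chi -signr_addb /twist /= parityD; congr (_ ^+ _); congr nat_of_bool.
by case: (parity _) (parity _) (parity _) g.2.2 h.2.2 k.2.1 => [] [] [] [] [] [].
Qed.

Lemma chi_sqr g h : chi g h * chi g h = 1.
Proof. by rewrite /chi -expr2 sqrr_sign. Qed.

(** The matrix algebra is extended by two central elements and by the two degree
    derivations of the torus. *)
Inductive torus_basis := Mon of grid | Cen of 'I_2 | Der of 'I_2.

Definition torus_basis_enc b : grid + 'I_2 + 'I_2 :=
  match b with Mon g => inl (inl g) | Cen i => inl (inr i) | Der i => inr i end.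
Definition torus_basis_dec c :=
  match c with inl (inl g) => Mon g | inl (inr i) => Cen i | inr i => Der i end.
Lemma torus_basis_encK : cancel torus_basis_enc torus_basis_dec.
Proof. by case. Qed.
HB.instance Definition _ := Equality.copy torus_basis (can_type torus_basis_encK).
HB.instance Definition _ := Choice.copy torus_basis (can_type torus_basis_encK).

Definition torus := {freeg torus_basis / K}.
HB.instance Definition _ := GRing.Lmodule.on torus.
Implicit Types (u v w : torus).

Local Notation U g := (<< Mon g >> : torus).
Local Notation C i := (<< Cen i >> : torus).
Local Notation E i := (<< Der i >> : torus).

Definition expo (i : 'I_2) (g : grid) : int := if i == 0 then g.1.1 else g.1.2.

Definition cen (n : int * int) : torus := n.1%:~R *: C 0 + n.2%:~R *: C 1.

(** The commutator of two monomials and the cocycle [tr (d_i u * v)], where the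
    trace picks the coefficient of the monomial 1. *)
Definition mon_bracket g h : torus :=
  (chi g h - chi h g) *: U (addg g h) +
  ((g.1 + h.1 == 0) && (g.2 == h.2))%:R * chi g h *: cen g.1.

Definition basis_bracket (b c : torus_basis) : torus :=
  match b, c with
  | Mon g, Mon h => mon_bracket g h
  | Der i, Mon g => (expo i g)%:~R *: U g
  | Mon g, Der i => - (expo i g)%:~R *: U g
  | _, _ => 0
  end.

Definition torus_bracket u v : torus :=
  fglift (fun b => fglift (basis_bracket b) v) u.

Lemma torus_bracket_linearl a u v w :
  torus_bracket (a *: u + v) w = a *: torus_bracket u w + torus_bracket v w.
Proof. exact: fglift_linear. Qed.

Lemma torus_bracket_linearr a u v w :
  torus_bracket w (a *: u + v) = a *: torus_bracket w u + torus_bracket w v.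
Proof.
rewrite /torus_bracket !fgliftE scaler_sumr -big_split /=.
by apply: eq_bigr => b _; rewrite fglift_linear scalerDr !scalerA mulrC.
Qed.

Lemma torus_bracketE b c : torus_bracket << b >> << c >> = basis_bracket b c.
Proof. by rewrite /torus_bracket !fgliftU. Qed.


Lemma cenD m n : cen (m + n) = cen m + cen n.
Proof. by rewrite /cen /= !intrD !scalerDl addrACA. Qed.

Lemma cenN m : cen (- m) = - cen m.
Proof. by rewrite /cen /= !mulrNz !scaleNr opprD. Qed.

Lemma addgC g h : addg g h = addg h g.
Proof. by rewrite /addg addrC addbC [g.2.2 (+) _]addbC. Qed.

Lemma addgA g h k : addg g (addg h k) = addg (addg g h) k.
Proof. by rewrite /addg /= addrA !addbA. Qed.

Lemma chi_opp g h : g.1 + h.1 = 0 -> g.2 = h.2 -> chi h g = chi g h.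
Proof.
move=> /eqP; rewrite addr_eq0 => /eqP g1 g2; rewrite /chi /twist.
congr (_ ^+ _); congr nat_of_bool; rewrite g1 g2 /=.
by rewrite !parityN andbC [h.2.2 && _]andbC.
Qed.

Lemma mon_bracketC g h : mon_bracket g h = - mon_bracket h g.
Proof.
rewrite /mon_bracket opprD -scaleNr opprB addgC; congr (_ + _).
rewrite [h.1 + _]addrC [h.2 == _]eq_sym.
have [gh|] := boolP (_ && _); last by rewrite !mul0r !scale0r oppr0.
have /andP[/eqP gh1 /eqP gh2] := gh.
rewrite !mul1r (chi_opp gh1 gh2) -scalerN -cenN; congr (_ *: cen _).
by apply/eqP; rewrite -addr_eq0 gh1.
Qed.

Lemma basis_bracketC b c : basis_bracket b c = - basis_bracket c b.
Proof.
case: b c => [g|i|i] [h|j|j] /=; rewrite ?oppr0 //.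
- exact: mon_bracketC.
- by rewrite scaleNr.
- by rewrite scaleNr opprK.
Qed.

Lemma torus_bracketC u v : torus_bracket u v = - torus_bracket v u.
Proof.
apply/eqP; rewrite -addr_eq0; apply/eqP; move: u; apply: freeg_ext => [a u w|b].
  by rewrite torus_bracket_linearl torus_bracket_linearr scalerDr addrACA.
move: v; apply: freeg_ext => [a u w|c].
  by rewrite torus_bracket_linearl torus_bracket_linearr scalerDr addrACA.
by rewrite !torus_bracketE basis_bracketC addNr.
Qed.

Lemma torus_bracketxx u : torus_bracket u u = 0.
Proof.
apply: (@scalerI _ _ (2 : K)); first by rewrite pnatr_eq0.
by rewrite scaler0 scaler_nat mulr2n {2}torus_bracketC subrr.
Qed.

Local Notation br := torus_bracket.

Let brZ a u v : br u (a *: v) = a *: br u v.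
Proof.
have := torus_bracket_linearr a v 0 u; rewrite !addr0 => ->.
suff -> : br u 0 = 0 by rewrite addr0.
by rewrite /torus_bracket fgliftE big1 // => b _; rewrite fglift0 scaler0.
Qed.

Let brD u v w : br u (v + w) = br u v + br u w.
Proof. by have := torus_bracket_linearr 1 v w u; rewrite !scale1r. Qed.

Let br0 u : br u 0 = 0.
Proof. by have := brZ 0 u 0; rewrite !scale0r. Qed.

Let br_cen b n : br << b >> (cen n) = 0.
Proof. by rewrite brD !brZ !torus_bracketE; case: b => *; rewrite /= !scaler0 addr0. Qed.

Let br_mon b g h : br << b >> (mon_bracket g h) =
  (chi g h - chi h g) *: basis_bracket b (Mon (addg g h)).
Proof. by rewrite brD !brZ br_cen scaler0 addr0 torus_bracketE. Qed.

Definition jacobiator u v w := br u (br v w) + br v (br w u) + br w (br u v).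

Let collect3 a1 a2 a3 b1 b2 b3 c1 c2 c3 (u v w : torus) :
  a1 + a2 + a3 = 0 -> b1 + b2 + b3 = 0 -> c1 + c2 + c3 = 0 ->
  (a1 *: u + (b1 *: v + c1 *: w)) + (a2 *: u + (b2 *: v + c2 *: w)) +
  (a3 *: u + (b3 *: v + c3 *: w)) = 0.
Proof.
have swap (x1 x2 x3 y1 y2 y3 : torus) :
    x1 + y1 + (x2 + y2) + (x3 + y3) = (x1 + x2 + x3) + (y1 + y2 + y3).
  by rewrite [x1 + y1 + _]addrACA [LHS]addrACA.
by move=> a0 b0 c0; rewrite swap swap -!scalerDl a0 b0 c0 !scale0r !addr0.
Qed.

Lemma chi_val g h : chi g h = 1 \/ chi g h = -1.
Proof. by rewrite /chi; case: (twist g h); [right|left]. Qed.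

(** When [g + h + k = 0] the values on the right determine all others, and the
    three central coefficients become equal. *)
Let chi_triangle g h k : g.1 + h.1 + k.1 = 0 ->
    g.2.1 (+) h.2.1 (+) k.2.1 = false -> g.2.2 (+) h.2.2 (+) k.2.2 = false ->
  [/\ chi g k = chi g g * chi g h, chi h k = chi h h * chi h g,
      chi k g = chi g g * chi h g & chi k h = chi h h * chi g h].
Proof.
move=> e e1 e2; have n0 x : chi x (addg (addg g h) k) = 1 /\ chi (addg (addg g h) k) x = 1.
  have -> : addg (addg g h) k = (0, (false, false)).
    by apply: injective_projections; rewrite /= ?e1 ?e2.
  by rewrite /chi /twist /= !andbF.
split.
- have [+ _] := n0 g; rewrite !chiDr => E.
  by rewrite -[RHS]mulr1 -(chi_sqr g k) mulrA E mul1r.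
- have [+ _] := n0 h; rewrite !chiDr => E.
  by rewrite -[RHS]mulr1 -(chi_sqr h k) mulrA [chi h h * _]mulrC E mul1r.
- have [_ +] := n0 g; rewrite !chiDl => E.
  by rewrite -[RHS]mulr1 -(chi_sqr k g) mulrA E mul1r.
- have [_ +] := n0 h; rewrite !chiDl => E.
  by rewrite -[RHS]mulr1 -(chi_sqr k h) mulrA [chi h h * _]mulrC E mul1r.
Qed.

(** The bicharacter settles the coefficient of the monomial.  The three central
    coefficients agree by [chi_triangle], and [cen] is additive with
    [g + h + k = 0]. *)
Lemma jacobi_mon g h k : jacobiator (U g) (U h) (U k) = 0.
Proof.
rewrite /jacobiator !torus_bracketE /= !br_mon /= /mon_bracket.
have -> : addg h (addg k g) = addg g (addg h k) by rewrite addgC -addgA addgC addgA.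
have -> : addg k (addg g h) = addg g (addg h k) by rewrite addgC -addgA.
pose d := (g.1 + h.1 + k.1 == 0) && ((g.2.1 (+) h.2.1 (+) k.2.1 == false) &&
  (g.2.2 (+) h.2.2 (+) k.2.2 == false)).
have -> : (g.1 + (addg h k).1 == 0) && (g.2 == (addg h k).2) = d.
  rewrite /d addrA -pair_eqE /pair_eq /=; congr (_ && _).
  by case: g.2 h.2 k.2 => [[] []] [[] []] [[] []].
have -> : (h.1 + (addg k g).1 == 0) && (h.2 == (addg k g).2) = d.
  rewrite /d [h.1 + _]addrA addrC addrA -pair_eqE /pair_eq /=; congr (_ && _).
  by case: g.2 h.2 k.2 => [[] []] [[] []] [[] []].
have -> : (k.1 + (addg g h).1 == 0) && (k.2 == (addg g h).2) = d.
  rewrite /d addrC -pair_eqE /pair_eq /=; congr (_ && _).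
  by case: g.2 h.2 k.2 => [[] []] [[] []] [[] []].
rewrite !scalerDr !scalerA !chiDr !chiDl.
have [/andP[/eqP e /andP[/eqP e1 /eqP e2]]|_] := boolP d; last first.
  rewrite mulr0n !mul0r !mulr0 !mul0r.
  by apply: collect3; ring.
have [-> -> -> ->] := chi_triangle e e1 e2.
have k1 : k.1.1 = - (g.1.1 + h.1.1).
  by apply/eqP; rewrite -addr_eq0 addrC; apply/eqP; have := congr1 fst e.
have k2 : k.1.2 = - (g.1.2 + h.1.2).
  by apply/eqP; rewrite -addr_eq0 addrC; apply/eqP; have := congr1 snd e.
rewrite mulr1n k1 k2 !mulrNz !intrD.
by apply: collect3; case: (chi_val g h) (chi_val h g) => [] -> [] ->; ring.
Qed.

(** [Der i] acts as a derivation: where the central term of the bracket does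
    not vanish, the two degrees are opposite. *)
Lemma mon_bracket_deg i g h :
  (chi g h - chi h g) *: ((expo i (addg g h))%:~R *: U (addg g h)) =
  (expo i g + expo i h)%:~R *: mon_bracket g h.
Proof.
have -> : expo i (addg g h) = expo i g + expo i h by rewrite /expo; case: ifP.
rewrite scalerDr !scalerA [RHS]addrC [_ * (chi g h - _)]mulrC.
have [/andP[/eqP gh _]|_] := boolP (_ && _); last by rewrite !mul0r mulr0 scale0r add0r.
have -> : expo i g + expo i h = 0.
  by rewrite /expo; case: ifP => _; [have := congr1 fst gh | have := congr1 snd gh].
by rewrite !mulr0z !mul0r !mulr0 !scale0r addr0.
Qed.

Lemma jacobi_basis b c d : jacobiator << b >> << c >> << d >> = 0.
Proof.
case: b c d => [g|i|i] [h|j|j] [k|l|l]; rewrite /jacobiator !torus_bracketE /=;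
  rewrite ?br_mon ?brZ ?br0 ?torus_bracketE /= ?addr0 ?add0r ?scaler0 ?addr0 //.
- by have := jacobi_mon g h k; rewrite /jacobiator !torus_bracketE /= !br_mon.
- rewrite mon_bracket_deg [mon_bracket h g]mon_bracketC scalerN scaleNr intrD scalerDl.
  by rewrite -opprD [_ *: _ + _ *: _]addrC addNr.
- rewrite mon_bracket_deg [mon_bracket g k]mon_bracketC scalerN scaleNr intrD scalerDl.
  by rewrite addKr subrr.
- by rewrite !scalerA -scalerDl [X in X *: _](_ : _ = 0) ?scale0r //; ring.
- rewrite mon_bracket_deg [mon_bracket k h]mon_bracketC scalerN scaleNr intrD scalerDl.
  by rewrite addrK subrr.
all: by rewrite !scalerA -scalerDl [X in X *: _](_ : _ = 0) ?scale0r //; ring.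
Qed.

Lemma torus_jacobi u v w : jacobiator u v w = 0.
Proof.
have lin1 v' w' a u1 u2 : jacobiator (a *: u1 + u2) v' w' =
    a *: jacobiator u1 v' w' + jacobiator u2 v' w'.
  rewrite /jacobiator !(torus_bracket_linearl, torus_bracket_linearr).
  by rewrite [X in X + _ = _]addrACA [LHS]addrACA !scalerDr.
have cyc u' v' w' : jacobiator u' v' w' = jacobiator v' w' u'.
  by rewrite /jacobiator -addrA addrC.
move: u; apply: freeg_ext => [a u1 u2|b]; first exact: lin1.
rewrite cyc; move: v; apply: freeg_ext => [a u1 u2|c]; first exact: lin1.
rewrite cyc; move: w; apply: freeg_ext => [a u1 u2|d]; first exact: lin1.
by rewrite cyc jacobi_basis.
Qed.

HB.instance Definition _ := Lmodule_isLie.Build K torus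
  torus_bracket_linearl torus_bracket_linearr torus_bracketxx torus_jacobi.

Lemma torus_lieE b c : (<< b >> : torus) ∙ << c >> = basis_bracket b c.
Proof. exact: torus_bracketE. Qed.

Definition torus_h : torus := U (0, (true, false)).

(** [e t^m] for [n = 1] and [f t^m] for [n = -1], as [e = (r + s r) / 2] and
    [f = (r - s r) / 2]. *)
Definition root_vec (n : int) (m : int * int) : torus :=
  2^-1 *: (U (m, (false, true)) + n%:~R *: U (m, (true, true))).

Definition cartan_vec (n : int) (m : int * int) : torus :=
  n%:~R *: torus_h + 2^-1 *: cen m.

Lemma lie_cen n u : cen n ∙ u = 0.
Proof.
move: u; apply: freeg_ext => [a u v|b]; first exact: lie_linearr.
rewrite lieC -[_ ∙ _]/(br _ _) br_cen oppr0 //.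
Qed.

Lemma lie_h_root (n : int) m : n = 1 \/ n = -1 ->
  torus_h ∙ root_vec n m = (2 * n)%:~R *: root_vec n m.
Proof.
move=> nn; rewrite /root_vec lieZr lieDr lieZr !torus_lieE /= /mon_bracket /=.
rewrite !andbF !mul0r !scale0r !addr0 /addg /= !add0r /chi /twist /= !andbF /=.
rewrite !scalerDr !scalerA [RHS]addrC.
by case: nn => ->; congr (_ *: _ + _ *: _); field.
Qed.

Lemma lie_root_opp (n : int) m : n = 1 \/ n = -1 -> ~~ (parity m.1 && parity m.2) ->
  root_vec n m ∙ root_vec (- n) (- m) = cartan_vec n m.
Proof.
move=> nn pm; rewrite /root_vec !lieZl !lieZr !lieDl !lieDr !lieZl !lieZr !torus_lieE /=.
rewrite /mon_bracket /=.
rewrite /addg /= !subrr /chi /twist /= !parityN /=.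
rewrite andbC (negbTE pm) /= expr0 expr1 !subrr !scale0r !mul0r !scale0r !addr0 !add0r.
rewrite /cartan_vec; move: (cen m) => c.
rewrite !scalerDr !scalerA [X in _ + X = _]addrC addrACA -!scalerDl [LHS]addrC.
by case: nn => ->; congr (_ *: _ + _ *: _); field.
Qed.

Lemma lie_der_root i n m :
  E i ∙ root_vec n m = (expo i (m, (true, true)))%:~R *: root_vec n m.
Proof.
rewrite /root_vec lieZr lieDr lieZr !torus_lieE /= !scalerDr !scalerA.
have -> : expo i (m, (false, true)) = expo i (m, (true, true)) by [].
by congr (_ *: _ + _ *: _); ring.
Qed.

Lemma lie_cartan_root p l n m : n = 1 \/ n = -1 ->
  cartan_vec p l ∙ root_vec n m = (2 * p * n)%:~R *: root_vec n m.
Proof.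
move=> nn; rewrite lieDl !lieZl lie_cen scaler0 addr0 lie_h_root // scalerA -intrM.
by congr (_%:~R *: _); rewrite mulrA [p * 2]mulrC.
Qed.

Lemma lie_cartan p l n m : cartan_vec p l ∙ cartan_vec n m = 0.
Proof.
rewrite lieDl !lieZl lie_cen scaler0 addr0 lieC lieDl !lieZl lie_cen liexx.
by rewrite !scaler0 addr0 oppr0 scaler0.
Qed.

Lemma lie_der_cartan i n m : E i ∙ cartan_vec n m = 0.
Proof.
rewrite lieDr !lieZr [_ ∙ cen m]lieC lie_cen oppr0 scaler0 addr0 torus_lieE /=.
by rewrite /expo; case: ifP; rewrite scale0r scaler0.
Qed.

Lemma lie_der i j : E i ∙ E j = 0.
Proof. exact: torus_lieE. Qed.


(** ** The symplectic part and its weights *)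

(** The monomials negated by the symplectic anti-involution, which fixes [t_1] and
    [t_2] and negates [s] and [r]: reversing [t_1^m t_2^n] costs a sign when
    [m] and [n] are both odd. *)
Definition odd_mon g : bool := (g.2.1 || g.2.2) (+) (parity g.1.1 && parity g.1.2).

Definition odd_part : set torus := [set u | forall g, coeff (Mon g) u != 0 -> odd_mon g].

Lemma odd0 : odd_part 0.
Proof. by move=> g; rewrite coeff0 eqxx. Qed.

Lemma oddD u v : odd_part u -> odd_part v -> odd_part (u + v).
Proof.
move=> ou ov g; rewrite coeffD.
have [->|/ou //] := eqVneq (coeff (Mon g) u) 0; rewrite add0r; exact: ov.
Qed.

Lemma oddZ a u : odd_part u -> odd_part (a *: u).
Proof. by move=> ou g; rewrite coeffZ mulf_eq0 negb_or => /andP[_ /ou]. Qed.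

Lemma odd_fglift (f : torus_basis -> torus) u :
  (forall b, coeff b u != 0 -> odd_part (f b)) -> odd_part (fglift f u).
Proof.
move=> of_; rewrite fgliftE big_seq; elim/big_ind: _ => [|v w|b]; first exact: odd0.
  exact: oddD.
by rewrite mem_dom => /of_; apply: oddZ.
Qed.

Lemma Mon_eq g h : (Mon g == Mon h) = (g == h).
Proof. by apply/eqP/eqP => [[->]|->]. Qed.

Lemma coeff_mon g h : coeff (Mon g) (U h) = (h == g)%:R :> K.
Proof. by rewrite coeffU mul1r Mon_eq. Qed.

Lemma coeff_cen g n : coeff (Mon g) (cen n) = 0.
Proof.
rewrite coeffD !coeffZ !coeffU (_ : (Cen 0 == Mon g) = false); last exact/eqP.
by rewrite (_ : (Cen 1 == Mon g) = false) ?mulr0 ?addr0 //; exact/eqP.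
Qed.

Lemma odd_mon_bracket g h : odd_mon g -> odd_mon h -> odd_part (mon_bracket g h).
Proof.
move=> og oh k; rewrite coeffD !coeffZ coeff_cen mulr0 addr0 coeff_mon.
have [<-|_] := eqVneq (addg g h) k; last by rewrite mulr0 eqxx.
rewrite mulr1 subr_eq0; move: og oh; rewrite /odd_mon /chi /twist /= !parityD.
case: g.2 h.2 (parity _) (parity _) (parity _) (parity _).
by move=> [] [] [[] []] [] [] [] [] //=; rewrite ?eqxx.
Qed.

Lemma odd_lie u v : odd_part u -> odd_part v -> odd_part (u ∙ v).
Proof.
move=> ou ov; apply: odd_fglift => b ub; apply: odd_fglift => c vc.
case: b c ub vc => [g|i|i] [h|j|j] //=; try by move=> *; apply: odd0.
- by move=> /ou og /ov; apply: odd_mon_bracket.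
- move=> /ou og _; apply: oddZ => k; rewrite coeff_mon.
  by case: (eqVneq g k) => [<-|]; rewrite ?eqxx.
- move=> _ /ov oh; apply: oddZ => k; rewrite coeff_mon.
  by case: (eqVneq h k) => [<-|]; rewrite ?eqxx.
Qed.

Lemma odd_root n m : ~~ (parity m.1 && parity m.2) -> odd_part (root_vec n m).
Proof.
move=> pm; apply/oddZ/oddD; last apply: oddZ.
  by move=> g; rewrite coeff_mon; case: (eqVneq _ g) => [<-|];
    rewrite ?eqxx // /odd_mon /= (negbTE pm).
by move=> g; rewrite coeff_mon; case: (eqVneq _ g) => [<-|];
  rewrite ?eqxx // /odd_mon /= (negbTE pm).
Qed.

Lemma coeff_basis b c : coeff b (<< c >> : torus) =
  match c, b with
  | Mon g, Mon h => (g == h)%:R | Cen i, Cen j => (i == j)%:R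
  | Der i, Der j => (i == j)%:R | _, _ => 0
  end :> K.
Proof.
rewrite coeffU mul1r; case: c b => [g|i|i] [h|j|j];
  try by [case: eqP => // -[]]; by congr (nat_of_bool _)%:R; apply/eqP/eqP => [[]|->].
Qed.

Definition flip g : grid := (g.1, (~~ g.2.1, g.2.2)).

Lemma coeff_notmon g b : (forall h, b != Mon h) -> coeff (Mon g) (<< b >> : torus) = 0.
Proof. by move=> bg; rewrite coeffU (negbTE (bg g)) mulr0. Qed.

Lemma lie_h_basis b : torus_h ∙ << b >> =
  if b is Mon h then (if h.2.2 then 2 else 0) *: U (flip h) else 0.
Proof.
rewrite torus_lieE; case: b => [h|i|i] //=; last first.
  by rewrite /expo; case: ifP; rewrite oppr0 scale0r.
have cen0 : cen 0 = 0 by apply: (addrI (cen 0)); rewrite -cenD !addr0.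
rewrite /mon_bracket cen0 scaler0 addr0 /chi /twist /= !andbF andbT /=.
rewrite /addg /= add0r; congr (_ *: _).
by case: h.2.2; rewrite ?expr0 ?expr1 ?subrr // opprK.
Qed.

Lemma coeff_lie_h g u :
  coeff (Mon g) (torus_h ∙ u) = if g.2.2 then 2 * coeff (Mon (flip g)) u else 0.
Proof.
apply/eqP; rewrite -subr_eq0; apply/eqP; move: u.
apply: (@freeg_ext _ _ K^o) => [a u v|b].
  rewrite lie_linearr !coeffD !coeffZ -[X in _ = X + _]/(a * _).
  by case: ifP => _; ring.
rewrite lie_h_basis; case: b => [h|i|i] /=; last 2 first.
- by rewrite coeff0 coeff_notmon // mulr0 if_same subrr.
- by rewrite coeff0 coeff_notmon // mulr0 if_same subrr.
rewrite coeffZ !coeff_mon.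
have -> : (flip h == g) = (h == flip g).
  by apply/eqP/eqP => [<-|->]; rewrite /flip /= negbK; [case: h => ? [] | case: g => ? []].
case: eqP => [->|_] /=; last by rewrite !mulr0 if_same subrr.
by case: ifP; rewrite ?mul0r subrr.
Qed.

Lemma coeff_lie_h0 b u : (forall g, b != Mon g) -> coeff b (torus_h ∙ u) = 0.
Proof.
move=> bg; move: u; apply: (@freeg_ext _ _ K^o) => [a u v|c].
  by rewrite lie_linearr coeffD coeffZ.
rewrite lie_h_basis; case: c => [h|i|i]; rewrite ?coeff0 //.
by rewrite coeffZ coeffU eq_sym (negbTE (bg _)) !mulr0.
Qed.

Lemma coeff_lie_der g i u :
  coeff (Mon g) (E i ∙ u) = (expo i g)%:~R * coeff (Mon g) u.
Proof.
apply/eqP; rewrite -subr_eq0; apply/eqP; move: u.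
apply: (@freeg_ext _ _ K^o) => [a u v|b].
  rewrite lie_linearr !coeffD !coeffZ -[X in _ = X + _]/(a * _).
  by ring.
rewrite torus_lieE; case: b => [h|j|j] /=; last 2 first.
- by rewrite coeff0 coeff_notmon // mulr0 subrr.
- by rewrite coeff0 coeff_notmon // mulr0 subrr.
by rewrite coeffZ coeff_mon; case: eqP => [->|_]; rewrite ?mulr0 subrr.
Qed.

(** On the span of [t^m r] and [t^m s r] the square of [ad torus_h] is 4, and
    [ad torus_h] kills [t^m] and [t^m s]; so the weight [n] is 1 or -1, and then
    [odd_mon] forbids two odd exponents. *)
Lemma odd_weight_eq0 (n : int) m u : odd_part u ->
    torus_h ∙ u = (2 * n)%:~R *: u ->
    (forall i, E i ∙ u = (expo i (m, (false, false)))%:~R *: u) ->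
    n <> 0 -> ~ ((n = 1 \/ n = -1) /\ ~~ (parity m.1 && parity m.2)) ->
  u = 0.
Proof.
move=> ou hu du n0 nR; have nK : (2 * n)%:~R != 0 :> K by rewrite intr_eq0; lia.
apply/eqP/freeg_eqP => b; rewrite coeff0.
have eq_h c : coeff c (torus_h ∙ u) = (2 * n)%:~R * coeff c u by rewrite hu coeffZ.
have [[g ->]|bg] : (exists g, b = Mon g) \/ (forall g, b != Mon g).
- by case: b => [g|i|i]; [left; exists g | right | right].
- have [//|z0] := eqVneq (coeff (Mon g) u) 0; case: nR.
  have dg i : expo i g = expo i (m, (false, false)).
    apply: (@intr_inj K); apply: (mulIf z0).
    by rewrite -coeff_lie_der du coeffZ.
  have g1 : g.1 = m.
    by apply: injective_projections; [exact: (dg 0) | exact: (dg 1)].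
  have [g22 E1] : g.2.2 /\ 2 * coeff (Mon (flip g)) u = (2 * n)%:~R * coeff (Mon g) u.
    have := eq_h (Mon g); rewrite coeff_lie_h; case: ifP => // _ /esym/eqP.
    by rewrite mulf_eq0 (negbTE nK) (negbTE z0).
  have := eq_h (Mon (flip g)); rewrite coeff_lie_h /= g22.
  have -> : flip (flip g) = g.
    by rewrite /flip /= negbK; case: g {ou hu du eq_h dg g1 g22 E1 z0} => ? [].
  move=> E2; have /(mulIf z0)/eqP :
      (2 * 2)%:~R * coeff (Mon g) u = ((2 * n) * (2 * n))%:~R * coeff (Mon g) u.
    by rewrite !intrM -mulrA E2 mulrCA E1 !intrM !mulrA.
  rewrite eqr_int => /eqP nn; split; first by nia.
  by have := ou g z0; rewrite /odd_mon g22 orbT g1 /=; case: (_ && _).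
- by apply: (mulfI nK); rewrite -eq_h coeff_lie_h0 ?mulr0.
Qed.

End QuantumTorus.

(** * The root system *)

Section RootSystem.
Context {R : realType} {V : vectType R}.
Variables (alpha sigma1 sigma2 : V) (form : V -> V -> R).
Hypothesis basisV : basis_of fullv [:: alpha; sigma1; sigma2].
Hypothesis psd : psd_symmetric_form setT form.
Hypothesis alpha2 : form alpha alpha = 2.
Hypothesis rad : radical setT form = lspan [set sigma1; sigma2].
Implicit Types (u v w b : V).

Local Notation Rs := (A1_R alpha sigma1 sigma2).
Local Notation lam := (A1_lambda alpha sigma1 sigma2).

Definition lev v : R := coord [tuple alpha; sigma1; sigma2] 0 v.

Lemma coordE v : v = lev v *: alpha + lam 0 v *: sigma1 + lam 1 v *: sigma2.
Proof.
rewrite {1}(coord_basis basisV (memvf v)) !big_ord_recl big_ord0 addr0 addrA.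
by congr (coord _ _ _ *: _ + coord _ _ _ *: _ + coord _ _ _ *: _); apply: val_inj.
Qed.

Lemma lev_linear a u v : lev (a *: u + v) = a * lev u + lev v.
Proof. by rewrite /lev linearP. Qed.

Lemma lam_linear (i : 'I_2) a u v : lam i (a *: u + v) = a * lam i u + lam i v.
Proof. by rewrite /A1_lambda linearP. Qed.

Lemma lev0 : lev 0 = 0. Proof. by rewrite /lev linear0. Qed.

Lemma lam0 (i : 'I_2) : lam i 0 = 0. Proof. by rewrite /A1_lambda linear0. Qed.

Lemma levD u v : lev (u + v) = lev u + lev v.
Proof. by rewrite -{1}[u]scale1r lev_linear mul1r. Qed.

Lemma lamD (i : 'I_2) u v : lam i (u + v) = lam i u + lam i v.
Proof. by rewrite -{1}[u]scale1r lam_linear mul1r. Qed.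

Lemma coord_inj u v : lev u = lev v -> (forall i, lam i u = lam i v) -> u = v.
Proof. by move=> e l; rewrite (coordE u) (coordE v) e !l. Qed.

Lemma coord_of (i j : 'I_3) : coord [tuple alpha; sigma1; sigma2] i
   [tuple alpha; sigma1; sigma2]`_j = (i == j)%:R.
Proof. by rewrite (coord_free j i (basis_free basisV)) eq_sym. Qed.

Definition pt (k m n : int) : V := alpha *~ k + sigma1 *~ m + sigma2 *~ n.

Lemma lev_pt k m n : lev (pt k m n) = k%:~R.
Proof.
rewrite /lev /pt !raddfD /= !raddfMz /=.
rewrite (coord_of 0 0) (coord_of 0 1) (coord_of 0 2) /=.
by rewrite !mul0rz !addr0.
Qed.

Lemma lam0_pt k m n : lam 0 (pt k m n) = m%:~R.
Proof.
rewrite /A1_lambda /pt !raddfD /= !raddfMz /=.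
rewrite (coord_of _ 0) (coord_of _ 1) (coord_of _ 2) /=.
by rewrite !mul0rz !addr0 add0r.
Qed.

Lemma lam1_pt k m n : lam 1 (pt k m n) = n%:~R.
Proof.
rewrite /A1_lambda /pt !raddfD /= !raddfMz /=.
rewrite (coord_of _ 0) (coord_of _ 1) (coord_of _ 2) /=.
by rewrite !mul0rz !add0r.
Qed.

Lemma pt_inj k m n k' m' n' : pt k m n = pt k' m' n' -> [/\ k = k', m = m' & n = n'].
Proof.
move=> e; split; apply: (@intr_inj R).
- by rewrite -(lev_pt k m n) e lev_pt.
- by rewrite -(lam0_pt k m n) e lam0_pt.
- by rewrite -(lam1_pt k m n) e lam1_pt.
Qed.

Lemma formDl a u v w : form (a *: u + v) w = a * form u w + form v w.
Proof. by case: psd => + _ _; apply. Qed.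

Lemma formC u v : form u v = form v u.
Proof. by case: psd => _ + _; apply. Qed.

Lemma form_sigma s w : s = sigma1 \/ s = sigma2 -> form s w = 0.
Proof.
move=> hs; suff [] : radical setT form s by move=> _; apply.
rewrite rad; exists 1%N, (fun _ => 1), (fun _ => s); split.
  by move=> _; case: hs => ->; [left|right].
by rewrite big_ord1 scale1r.
Qed.

Lemma formE u v : form u v = 2 * (lev u * lev v).
Proof.
have f0 w : form 0 w = 0.
  by apply: (addrI (form 0 w)); have := formDl 1 0 0 w; rewrite scale1r !addr0 mul1r.
have fl w x : form w x = lev w * form alpha x.
  have s1 : form sigma1 x = 0 by apply: form_sigma; left.
  have s2 : form sigma2 x = 0 by apply: form_sigma; right.
  rewrite {1}(coordE w) -addrA !formDl s1 mulr0 add0r.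
  by rewrite -[_ *: sigma2]addr0 formDl s2 f0 mulr0 !addr0.
by rewrite fl formC fl alpha2; ring.
Qed.

Lemma pt_add k m n k' m' n' : pt k m n + pt k' m' n' = pt (k + k') (m + m') (n + n').
Proof. by rewrite /pt addrACA [X in X + _ = _]addrACA -!mulrzDr. Qed.

Lemma pt_opp k m n : - pt k m n = pt (- k) (- m) (- n).
Proof. by rewrite /pt !opprD !mulrNz. Qed.

(** Coordinates of the roots: [S] consists of the [sigma1 *~ m + sigma2 *~ n] with
    [m], [n] not both odd. *)
Definition is_root (k m n : int) : Prop :=
  k = 0 \/ (k = 1 \/ k = -1) /\ ~~ (parity m && parity n).

Lemma alpha_pt : alpha = pt 1 0 0. Proof. by rewrite /pt !mulr0z !addr0. Qed.
Lemma sigma1_pt : sigma1 = pt 0 1 0. Proof. by rewrite /pt !mulr0z add0r addr0. Qed.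
Lemma sigma2_pt : sigma2 = pt 0 0 1. Proof. by rewrite /pt !mulr0z !add0r. Qed.

Lemma A1_RP b : Rs b <-> exists k m n, b = pt k m n /\ is_root k m n.
Proof.
have LE m n : sigma1 *~ m + sigma2 *~ n = pt 0 m n by rewrite /pt mulr0z add0r.
split.
  case=> [[m [n ->]]|[s [l [m [n ->]] hs] hb]].
    by exists 0, m, n; rewrite LE; split=> //; left.
  have {hs} [m' [n' [es pmn]]] : exists m' n', s = pt 0 m' n' /\ ~~ (parity m' && parity n').
    rewrite LE mulr2n sigma1_pt sigma2_pt !pt_add in hs.
    by case: hs => ->; do 2!eexists; (split; first by []); rewrite /parity; lia.
  case: hb => ->; rewrite es alpha_pt ?pt_opp pt_add.
    by exists 1, m', n'; rewrite addr0 !add0r; split=> //; right; split=> //; left.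
  by exists (-1), m', n'; rewrite addr0 oppr0 !add0r; split=> //; right; split=> //; right.
move=> [k [m [n [-> []]]]] => [->|[hk pmn]]; first by left; exists m, n.
right; exists (pt 0 m n); last first.
  by rewrite alpha_pt pt_opp !pt_add oppr0 !add0r !addr0; case: hk => ->; [left|right].
have [m' em] := parityE m; have [n' en] := parityE n.
exists (pt 0 m' n'); first by exists m', n'; rewrite LE.
rewrite mulr2n sigma1_pt sigma2_pt !pt_add !add0r em en.
case: (parity m) (parity n) pmn => [] [] // _; [constructor 2|constructor 3|constructor 1];
  by congr pt; lia.
Qed.

Definition aniso := anisotropic_roots setT form Rs.

Lemma anisoP b : aniso b <-> exists k m n,
  [/\ b = pt k m n, k = 1 \/ k = -1 & ~~ (parity m && parity n)].
Proof.
split.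
  move=> [/A1_RP[k [m [n [-> hk]]]] hn].
  exists k, m, n; case: hk => [k0|[hk pmn] //]; case: hn; split.
    by apply/A1_RP; exists k, m, n; split=> //; left.
  by split=> // w _; rewrite formE lev_pt k0 mul0r mulr0.
move=> [k [m [n [-> hk pmn]]]]; split.
  by apply/A1_RP; exists k, m, n; split=> //; right.
move=> [_ [_ /(_ alpha I)]]; rewrite alpha_pt formE !lev_pt mulr1.
by move/eqP; rewrite mulf_eq0 pnatr_eq0 intr_eq0 /=; case: hk => ->.
Qed.

Lemma corootE k m n : k = 1 \/ k = -1 -> coroot form (pt k m n) = pt k m n.
Proof.
rewrite /coroot formE lev_pt => hk.
rewrite (_ : 2 / _ = 1) ?scale1r //.
by case: hk => ->; field.
Qed.

Local Notation bas := (fun i : 'I_3 => [tuple alpha; sigma1; sigma2]`_i).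

Lemma A1_basis : is_basis setT bas.
Proof.
split; last exact/freeP/(basis_free basisV).
apply/seteqP; split=> // v _; exists 3%N, (fun i => coord [tuple alpha; sigma1; sigma2] i v), bas.
split=> [i|]; first by exists i.
exact: coord_basis basisV (memvf v).
Qed.

Lemma radE v : radical setT form v <-> lev v = 0.
Proof.
split=> [[_ /(_ alpha I)]|v0]; last by split=> // w _; rewrite formE v0 mul0r mulr0.
rewrite formE alpha_pt lev_pt mulr1 => /eqP; rewrite mulf_eq0 pnatr_eq0 /=.
by move=> /eqP.
Qed.

Lemma rad_dim : has_dim (radical setT form) 2.
Proof.
exists (fun i : 'I_2 => if i == 0 then sigma1 else sigma2); split.
  rewrite rad; apply/seteqP; split=> v [n [c [a [ha ->]]]]; exists n, c, a; split=> // i.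
    by case: (ha i) => ->; [exists 0 | exists 1].
  by case: (ha i) => j _ <-; case: ifP; [left|right].
move=> c; rewrite !big_ord_recl big_ord0 addr0 /= => e.
have l0 : lam 0 (c 0 *: sigma1 + c 1 *: sigma2) = c 0.
  have := lam0_pt 0 1 0; have := lam0_pt 0 0 1; rewrite -sigma1_pt -sigma2_pt => s2 s1.
  rewrite -[c 1 *: _]addr0 !lam_linear s1 s2.
  by rewrite /A1_lambda linear0 mulr0 mulr1 !addr0.
have l1 : lam 1 (c 0 *: sigma1 + c 1 *: sigma2) = c 1.
  have := lam1_pt 0 1 0; have := lam1_pt 0 0 1; rewrite -sigma1_pt -sigma2_pt => s2 s1.
  rewrite -[c 1 *: _]addr0 !lam_linear s1 s2.
  by rewrite /A1_lambda linear0 mulr0 mulr1 add0r addr0.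
have l00 i : lam i 0 = 0 by rewrite /A1_lambda linear0.
move: l0 l1; have -> : c 0 *: sigma1 + c 1 *: sigma2 = 0.
  by rewrite -[RHS]e; congr (c _ *: _ + c _ *: _); apply: val_inj.
rewrite !l00 => c0 c1 i; case: i => [[|[|//]]] lti.
  by rewrite [RHS]c0; congr c; apply: val_inj.
by rewrite [RHS]c1; congr c; apply: val_inj.
Qed.

Lemma pt0 : pt 0 0 0 = 0. Proof. by rewrite /pt !mulr0z !addr0. Qed.

Lemma pt_mulz k m n p : pt k m n *~ p = pt (k * p) (m * p) (n * p).
Proof. by rewrite /pt !mulrzDl -!mulrzA. Qed.

Lemma pt_zspan k m n : zspan (range bas) (pt k m n).
Proof.
exists 3%N, (fun i => [:: k; m; n]`_i), bas; split=> [i|]; first by exists i.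
by rewrite !big_ord_recl big_ord0 addr0 addrA.
Qed.

Lemma A1_lattice : zspan Rs = zspan (range bas).
Proof.
apply/seteqP; split=> x [p [c [a [ha ->]]]]; last first.
  exists p, c, a; split=> // i; apply/A1_RP; have [j _ <-] := ha i.
  case: (ord3P j) => /=.
  - by exists 1, 0, 0; rewrite alpha_pt; split=> //; right; split=> //; left.
  - by exists 0, 1, 0; rewrite sigma1_pt; split=> //; left.
  - by exists 0, 0, 1; rewrite sigma2_pt; split=> //; left.
suff [k [m [n ->]]] : exists k m n, \sum_(i < p) a i *~ c i = pt k m n by apply: pt_zspan.
elim/big_ind: _ => [|u v [k [m [n ->]]] [k' [m' [n' ->]]]|i _].
- by exists 0, 0, 0; rewrite /pt !mulr0z !addr0.
- by rewrite pt_add; do 3!eexists.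
- have /A1_RP[k [m [n [-> _]]]] := ha i.
  by rewrite pt_mulz; do 3!eexists.
Qed.

Lemma A1_elliptic : elliptic_root_system setT form Rs.
Proof.
split; last exact: rad_dim.
split.
- by exists 3%N; exists (fun i : 'I_3 => [tuple alpha; sigma1; sigma2]`_i); apply: A1_basis.
- exact: psd.
- by [].
- exists 3%N, (fun i : 'I_3 => [tuple alpha; sigma1; sigma2]`_i); split; first exact: A1_basis.
  exact: A1_lattice.
- move=> b g /anisoP[k [m [n [-> hk _]]]] /anisoP[k' [m' [n' [-> hk' _]]]].
  rewrite corootE // formE !lev_pt.
  by rewrite -intrM -(intrM _ 2) intr_int.
- move=> b g /A1_RP[k [m [n [-> hb]]]] /anisoP[k' [m' [n' [-> hk' pg]]]].
  rewrite corootE // formE !lev_pt -intrM -(intrM _ 2) scaler_int pt_mulz pt_opp pt_add.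
  apply/A1_RP; do 3!eexists; split; first by [].
  case: hb => [->|[hk pmn]]; first by left; rewrite !mul0r !mulr0 subr0.
  right; case: hk hk' => -> [] ->; (split; first by [left|right]);
    move: pmn; rewrite /parity; lia.
- apply/seteqP; split=> x.
    move=> [/A1_RP[k [m [n [-> _]]]] hr]; split=> //; have := hr.
    rewrite radE lev_pt => /eqP; rewrite intr_eq0 => /eqP ->.
    have [/andP[pm pn]|pmn] := boolP (parity m && parity n).
      exists (pt 1 m 0), (pt 1 0 (- n)); rewrite pt_opp pt_add; split.
      - by apply/anisoP; exists 1, m, 0; rewrite /= andbF; split=> //; left.
      - by apply/anisoP; exists 1, 0, (- n); split=> //; left.
      - by rewrite subrr oppr0 opprK addr0 add0r.
    exists (pt 1 m n), (pt 1 0 0); rewrite pt_opp pt_add; split.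
    - by apply/anisoP; exists 1, m, n; split=> //; left.
    - by apply/anisoP; exists 1, 0, 0; split=> //; left.
    - by rewrite subrr oppr0 !addr0.
  move=> [hr [b [g [/anisoP[k [m [n [-> _ _]]]] /anisoP[k' [m' [n' [-> _ _]]]] e]]]].
  split=> //; apply/A1_RP; move: hr; rewrite e pt_opp pt_add radE lev_pt.
  move=> /eqP; rewrite intr_eq0 => /eqP ->.
  by do 3!eexists; split; [|left].
- move=> g /anisoP[k [m [n [-> hk _]]]] /A1_RP[k' [m' [n' [e hr]]]].
  rewrite scaler_nat mulr2n pt_add in e; have [e1 _ _] := pt_inj e.
  by case: hr => [|[hr _]]; case: hk; lia.
- by exists alpha; apply/anisoP; exists 1, 0, 0; rewrite alpha_pt; split=> //; left.
- move=> [A1 [A2 [[x A1x] [z A2z] _ eA ort]]].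
  have /anisoP[k [m [n [ex hk _]]]] : aniso x by rewrite /aniso eA; left.
  have /anisoP[k' [m' [n' [ez hk' _]]]] : aniso z by rewrite /aniso eA; right.
  have /eqP := ort x z A1x A2z; rewrite ex ez formE !lev_pt.
  by rewrite !mulf_eq0 pnatr_eq0 !intr_eq0 /=; case: hk => ->; case: hk' => ->.
Qed.

End RootSystem.

(** * Transport of a root system along a linear injection *)

Section Transport.
Context {R : realType} {V W : lmodType R}.
Variables (iota : V -> W) (form : V -> V -> R) (B : W -> W -> R) (Rs : set V).
Hypothesis iota_lin : forall a u v, iota (a *: u + v) = a *: iota u + iota v.
Hypothesis iota_inj : injective iota.
Hypothesis BE : forall u v, B (iota u) (iota v) = form u v.

Let iota0 : iota 0 = 0.
Proof. by apply: (addrI (iota 0)); have := iota_lin 1 0 0; rewrite !scale1r !addr0. Qed.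

Let iotaZ a u : iota (a *: u) = a *: iota u.
Proof. by rewrite -[a *: u]addr0 iota_lin iota0 addr0. Qed.

Let iotaD u v : iota (u + v) = iota u + iota v.
Proof. by rewrite -[u]scale1r iota_lin !scale1r. Qed.

Let iotaN u : iota (- u) = - iota u.
Proof. by rewrite -scaleN1r iotaZ scaleN1r. Qed.

Let iota_sum n (F : 'I_n -> V) : iota (\sum_(i < n) F i) = \sum_(i < n) iota (F i).
Proof. exact: (big_morph _ iotaD iota0). Qed.

Let iota_mulz u (k : int) : iota (u *~ k) = iota u *~ k.
Proof. by rewrite -!scaler_int iotaZ. Qed.

Lemma lspan_image (A : set V) : lspan (iota @` A) = iota @` lspan A.
Proof.
apply/seteqP; split=> w.
  move=> [n [c [a [ha ->]]]].
  have /choice[b hb] : forall i, exists u, A u /\ iota u = a i.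
    by move=> i; have [u Au e] := ha i; exists u.
  exists (\sum_(i < n) c i *: b i).
    by exists n, c, b; split=> // i; have [] := hb i.
  by rewrite iota_sum; apply: eq_bigr => i _; rewrite iotaZ (hb i).2.
move=> [u [n [c [a [ha ->]]]] <-]; exists n, c, (iota \o a); split=> [i|].
  by exists (a i).
by rewrite iota_sum; apply: eq_bigr => i _; rewrite iotaZ.
Qed.

Lemma zspan_image (A : set V) : zspan (iota @` A) = iota @` zspan A.
Proof.
apply/seteqP; split=> w.
  move=> [n [c [a [ha ->]]]].
  have /choice[b hb] : forall i, exists u, A u /\ iota u = a i.
    by move=> i; have [u Au e] := ha i; exists u.
  exists (\sum_(i < n) b i *~ c i).
    by exists n, c, b; split=> // i; have [] := hb i.
  by rewrite iota_sum; apply: eq_bigr => i _; rewrite iota_mulz (hb i).2.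
move=> [u [n [c [a [ha ->]]]] <-]; exists n, c, (iota \o a); split=> [i|].
  by exists (a i).
by rewrite iota_sum; apply: eq_bigr => i _; rewrite iota_mulz.
Qed.

Lemma basis_image (S : set V) n (b : 'I_n -> V) :
  is_basis S b -> is_basis (iota @` S) (iota \o b).
Proof.
move=> [-> fb]; split; first by rewrite -lspan_image image_comp.
move=> c e; apply: fb; apply: iota_inj; rewrite iota0 -e iota_sum.
by apply: eq_bigr => i _; rewrite iotaZ.
Qed.

Lemma dim_image (S : set V) n : has_dim S n -> has_dim (iota @` S) n.
Proof. by move=> [b hb]; exists (iota \o b); apply: basis_image. Qed.

Lemma radical_image : radical (range iota) B = iota @` radical setT form.
Proof.
apply/seteqP; split=> w.
  move=> [[u _ <-] h]; exists u => //; split=> // v _; rewrite -BE.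
  by apply: h; exists v.
move=> [u [_ h] <-]; split; first by exists u.
by move=> _ [v _ <-]; rewrite BE; apply: h.
Qed.

Let isoE : isotropic_roots (range iota) B (iota @` Rs) =
  iota @` isotropic_roots setT form Rs.
Proof.
rewrite /isotropic_roots radical_image; apply/seteqP; split=> w.
  move=> [[u Ru <-] [v rv /iota_inj e]]; exists u => //; split=> //.
  by rewrite -e.
by move=> [u [Ru ru] <-]; split; exists u.
Qed.

Let anisoE : anisotropic_roots (range iota) B (iota @` Rs) =
  iota @` anisotropic_roots setT form Rs.
Proof.
rewrite /anisotropic_roots isoE; apply/seteqP; split=> w.
  move=> [[u Ru <-] nu]; by exists u; [split=> // iu; apply: nu; exists u | ].
by move=> [u [Ru nu] <-]; split; [exists u | move=> [v iv /iota_inj e]; apply: nu; rewrite -e].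
Qed.

Let coroot_image u : coroot B (iota u) = iota (coroot form u).
Proof. by rewrite /coroot iotaZ BE. Qed.

Lemma elliptic_image : elliptic_root_system setT form Rs ->
  elliptic_root_system (range iota) B (iota @` Rs).
Proof.
move=> [[[n fd] [fl fs fp] _ [m [b [bb zb]]] int refl iso red ne irr] rd].
split; last by rewrite radical_image; apply: dim_image.
split.
- by exists n; apply: dim_image.
- split.
  + by move=> a _ _ _ [u _ <-] [v _ <-] [w _ <-]; rewrite -iota_lin !BE fl.
  + by move=> _ _ [u _ <-] [v _ <-]; rewrite !BE fs.
  + by move=> _ [u _ <-]; rewrite BE fp.
- by move=> _ [u _ <-]; exists u.
- exists m, (iota \o b); split; first exact: basis_image.
  by rewrite zspan_image zb -zspan_image image_comp.
- move=> x y; rewrite anisoE => -[u au <-] [v av <-].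
  by rewrite coroot_image BE; apply: int.
- move=> x y; rewrite anisoE => -[u Ru <-] [v av <-].
  rewrite coroot_image BE -iotaZ -iotaN -iotaD; eexists; last by [].
  exact: refl.
- rewrite isoE anisoE radical_image iso; apply/seteqP; split=> w.
    move=> [u [ru [x [y [ax ay e]]]] <-]; split; first by exists u.
    by exists (iota x), (iota y); split; [exists x | exists y | rewrite -iotaN -iotaD e].
  move=> [[u ru <-] [_ [_ [[x ax <-] [y ay <-]]]]].
  rewrite -iotaN -iotaD => /iota_inj e; exists u => //; split=> //.
  by exists x, y.
- rewrite anisoE => _ [u au <-] [v Rv]; rewrite -iotaZ => /iota_inj e.
  by apply: (red u au); rewrite -e.
- by rewrite anisoE; have [u au] := ne; exists (iota u), u.
- rewrite anisoE => -[A1 [A2 [[x Ax] [y Ay] dis eA ort]]]; apply: irr.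
  exists (iota @^-1` A1), (iota @^-1` A2); split.
  + have [u _ e] : (iota @` anisotropic_roots setT form Rs) x by rewrite eA; left.
    by exists u; rewrite /= e.
  + have [u _ e] : (iota @` anisotropic_roots setT form Rs) y by rewrite eA; right.
    by exists u; rewrite /= e.
  + by rewrite -preimage_setI dis preimage_set0.
  + apply/seteqP; split=> u.
      move=> au; have : (iota @` anisotropic_roots setT form Rs) (iota u) by exists u.
      by rewrite eA.
    move=> Au; have : (iota @` anisotropic_roots setT form Rs) (iota u) by rewrite eA.
    by move=> [v av /iota_inj <-].
  + by move=> u v Au Av; rewrite -BE; apply: ort.
Qed.

End Transport.

(** * The presented algebra *)

Section Presented.
Local Open Scope complex_scope.
Context {R : realType} {V : vectType R}.
Variables (alpha sigma1 sigma2 : V) (form : V -> V -> R).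
Hypothesis basisV : basis_of fullv [:: alpha; sigma1; sigma2].
Hypothesis psd : psd_symmetric_form setT form.
Hypothesis alpha2 : form alpha alpha = 2.
Hypothesis rad : radical setT form = lspan [set sigma1; sigma2].
Implicit Types (u v w b : V).

Local Notation Rs := (A1_R alpha sigma1 sigma2).
Local Notation lam := (A1_lambda alpha sigma1 sigma2).
Local Notation lev := (lev alpha sigma1 sigma2).
Local Notation pt := (pt alpha sigma1 sigma2).
Local Notation Ppm := (A1_Ppm alpha sigma1 sigma2).
Local Notation gen := (A1_gen alpha sigma1 sigma2).
Local Notation L := (A1_Lhat alpha sigma1 sigma2 form).
Local Notation C := (R[i] : numFieldType).
Local Notation T := (@torus C).
Local Notation rel := (@A1_rel R V alpha sigma1 sigma2 form).

Lemma Ppm_cases b : Ppm b <->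
  [\/ b = pt 1 0 0, b = pt 1 (-1) 0 | b = pt 1 0 (-1)] \/
  [\/ b = pt (-1) 0 0, b = pt (-1) 1 0 | b = pt (-1) 0 1].
Proof.
have e0 : alpha = pt 1 0 0 by apply: alpha_pt.
have e1 : sigma1 - alpha = pt (-1) 1 0.
  have -> : pt (-1) 1 0 = pt 0 1 0 - pt 1 0 0 by rewrite pt_opp pt_add.
  by rewrite -alpha_pt -sigma1_pt.
have e2 : sigma2 - alpha = pt (-1) 0 1.
  have -> : pt (-1) 0 1 = pt 0 0 1 - pt 1 0 0 by rewrite pt_opp pt_add.
  by rewrite -alpha_pt -sigma2_pt.
rewrite /A1_Ppm /A1_P /=; split.
  have neg k m n w : w = pt k m n -> - w = pt (- k) (- m) (- n) by move=> ->; apply: pt_opp.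
  case=> [[[e|e]|e]|[_ [[->|->]|->] e]].
  - by left; constructor 1; apply: etrans e0.
  - by right; constructor 2; apply: etrans e1.
  - by right; constructor 3; apply: etrans e2.
  - by right; constructor 1; rewrite -e (neg _ _ _ _ e0) oppr0.
  - by left; constructor 2; rewrite -e (neg _ _ _ _ e1) oppr0.
  - by left; constructor 3; rewrite -e (neg _ _ _ _ e2) oppr0.
have N b' : [set alpha; sigma1 - alpha; sigma2 - alpha] (- b') -> Ppm b'.
  by move=> Pb; right; exists (- b') => //; rewrite opprK.
case=> [] [] ->.
- by left; left; left; apply: esym e0.
- by apply: N; left; right; rewrite pt_opp oppr0 -e1.
- by apply: N; right; rewrite pt_opp oppr0 -e2.
- by apply: N; left; left; rewrite pt_opp oppr0 -e0.
- by left; left; right; rewrite -e1.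
- by left; right; rewrite -e2.
Qed.

Lemma Ppm_pt (b : Ppm) : exists k m n,
  [/\ val b = pt k m n, k = 1 \/ k = -1 & ~~ (parity m && parity n)].
Proof.
have /Ppm_cases := set_valP b.
by case=> [] [] ->; do 3!eexists; (split; first by []); rewrite //;
  [left|left|left|right|right|right].
Qed.

(** The coordinates of the elements of [A1_Ppm] are integers, which the integer
    part recovers from the reals. *)
Definition ipart (r : R) : int := Num.floor r.

Definition root_of v : T := root_vec (ipart (lev v)) (ipart (lam 0 v), ipart (lam 1 v)).

(** The image of [H_v], written as an additive function of all of [V]: the linear
    relations between the [H_b] then hold without inspecting them. *)
Definition cartan_of v : T :=
  (lev v)%:C *: torus_h + 2^-1 *: ((lam 0 v)%:C *: << Cen 0 >> + (lam 1 v)%:C *: << Cen 1 >>).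

Definition gen_image (x : gen) : T :=
  match x with
  | gX b => root_of (val b)
  | gH b => cartan_of (val b)
  | gd i => << Der i >>
  end.

Lemma root_of_pt k m n : root_of (pt k m n) = root_vec k (m, n).
Proof.
by rewrite /root_of /ipart (lev_pt basisV) (lam0_pt basisV) (lam1_pt basisV) !intrKfloor.
Qed.

Lemma cartan_of_pt k m n : cartan_of (pt k m n) = cartan_vec k (m, n).
Proof.
rewrite /cartan_of (lev_pt basisV) (lam0_pt basisV) (lam1_pt basisV).
by rewrite !rmorph_int.
Qed.

Lemma cartan_of_sum (I : Type) (s : seq I) (F : I -> V) :
  cartan_of (\sum_(i <- s) F i) = \sum_(i <- s) cartan_of (F i).
Proof.
apply: big_morph => [u v|].
  rewrite /cartan_of levD !lamD !rmorphD /= !scalerDl.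
  have swap (a b c d e f : T) :
      a + b + 2^-1 *: (c + d + (e + f)) = a + 2^-1 *: (c + e) + (b + 2^-1 *: (d + f)).
    by rewrite [c + d + _]addrACA scalerDr addrACA.
  exact: swap.
by rewrite /cartan_of lev0 !lam0 !scale0r addr0 scaler0 addr0.
Qed.

Lemma formCE (b g : Ppm) (k m n k' m' n' : int) :
  val b = pt k m n -> val g = pt k' m' n' -> k = 1 \/ k = -1 ->
  form (val g) (coroot form (val b)) = (2 * k * k')%:~R.
Proof.
move=> eb eg hk; rewrite eb eg (corootE basisV psd alpha2 rad) //.
rewrite (formE basisV psd alpha2 rad) !(lev_pt basisV) -intrM -(intrM _ 2).
by congr _%:~R; lia.
Qed.

Local Notation "''X_' b" := (LGen (gX b)) (at level 8, b at level 2).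
Local Notation eval := (lie_eval gen_image).

(** The weight of an iterated bracket of generators is the sum of theirs, and
    it stays in the symplectic part. *)
Lemma nested_image (c : Ppm) (s : seq Ppm) k m n :
    \sum_(e <- c :: s) val e = pt k m n ->
    let z := eval (nested_br 'X_c [seq 'X_e | e <- s]) in
  [/\ odd_part z, torus_h ∙ z = (2 * k)%:~R *: z &
    forall i, (<< Der i >> : T) ∙ z = (expo i ((m, n), (false, false)))%:~R *: z].
Proof.
elim: s c k m n => [|d s IHs] c k m n /=.
  rewrite big_seq1; have [k' [m' [n' [-> hk pmn]]]] := Ppm_pt c.
  move=> /(pt_inj basisV)[<- <- <-]; rewrite root_of_pt; split.
  - exact: odd_root.
  - exact: lie_h_root.
  - by move=> i; rewrite lie_der_root.
rewrite big_cons; set w := \sum_(e <- _) _.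
have [k1 [m1 [n1 [ec hk pmn]]]] := Ppm_pt c.
rewrite ec => /(canRL (addKr _)); rewrite pt_opp pt_add => ew.
have /= [o1 o2 o3] := IHs d _ _ _ ew; rewrite root_of_pt; split.
- by apply: odd_lie => //; apply: odd_root.
- rewrite lieL lie_h_root // o2 lieZl lieZr -scalerDl -intrD.
  by congr (_%:~R *: _); lia.
- move=> i; rewrite lieL lie_der_root o3 lieZl lieZr -scalerDl -intrD.
  by congr (_%:~R *: _); rewrite /expo /=; case: ifP => _; lia.
Qed.

Lemma lam_expo (i : 'I_2) k m n x : (lam i (pt k m n))%:C = (expo i ((m, n), x))%:~R :> C.
Proof.
rewrite /expo; case: ifPn => [/eqP ->|i0]; first by rewrite (lam0_pt basisV) rmorph_int.
have -> : i = 1 by case: i i0 => [[|[|//]]] lti // _; apply: val_inj.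
by rewrite (lam1_pt basisV) rmorph_int.
Qed.

Lemma gen_image_rel (u v : lie_word R[i] gen) : rel u v -> eval u = eval v.
Proof.
case=> {u v}.
- move=> s g _ _ e /=; rewrite -e cartan_of_sum.
  elim: s {e} => [|b s IHs]; first by rewrite !big_nil.
  by rewrite !big_cons /= IHs.
- move=> b g /=.
  have [k [m [n [-> _ _]]]] := Ppm_pt b; have [k' [m' [n' [-> _ _]]]] := Ppm_pt g.
  by rewrite !cartan_of_pt lie_cartan.
- move=> b g /=.
  have [k [m [n [eb hk _]]]] := Ppm_pt b; have [k' [m' [n' [eg hk' _]]]] := Ppm_pt g.
  rewrite (formCE eb eg hk) eb eg cartan_of_pt root_of_pt lie_cartan_root //.
  by rewrite rmorph_int.
- move=> b b' e; rewrite -[LHS]/(root_of (val b) ∙ root_of (val b')) e.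
  rewrite -[RHS]/(cartan_of (val b)).
  have [k [m [n [-> hk pmn]]]] := Ppm_pt b.
  by rewrite pt_opp !root_of_pt cartan_of_pt (lie_root_opp hk (m := (m, n))).
- move=> b s nR; have [k [m [n e]]] : exists k m n, \sum_(c <- b :: s) val c = pt k m n.
    elim: (b :: s) => [|c s' [k' [m' [n' IHs]]]].
      by exists 0, 0, 0; rewrite big_nil pt0.
    rewrite big_cons IHs; have [k [m [n [-> _ _]]]] := Ppm_pt c.
    by rewrite pt_add; do 3!eexists.
  have [o1 o2 o3] := nested_image e; apply: (odd_weight_eq0 o1 o2 o3).
    by move=> k0; apply: nR; rewrite e; apply/(A1_RP basisV); exists k, m, n; split=> //; left.
  by move=> hk; apply: nR; rewrite e; apply/(A1_RP basisV); exists k, m, n; split=> //; right.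
- move=> i b /=; have [k [m [n [-> _ _]]]] := Ppm_pt b.
  by rewrite root_of_pt lie_der_root (lam_expo _ _ _ _ (true, true)).
- by move=> i j /=; rewrite lie_der.
- move=> i b /=; have [k [m [n [-> _ _]]]] := Ppm_pt b.
  by rewrite cartan_of_pt lie_der_cartan.
Qed.

Lemma model_hom : exists f : L -> T,
  [/\ forall a x y, f (a *: x + y) = a *: f x + f y,
      forall x y, f (x ∙ y) = f x ∙ f y
    & forall x, f (lie_gen rel x) = gen_image x].
Proof.
have [f [[fl fb fg] _]] := presented_lie_up gen_image_rel.
by exists f.
Qed.

(** Its values on the [H_b] and [d_i] serve twice: as coordinates, to view a vector
    of [V] as a functional, and to see that these elements are independent. *)
Definition phi : L -> T := projT1 (cid model_hom).

Lemma phi_linear a x y : phi (a *: x + y) = a *: phi x + phi y.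
Proof. by rewrite /phi; case: cid => f [fl _ _] /=; apply: fl. Qed.

Lemma phi_gen x : phi (lie_gen rel x) = gen_image x.
Proof. by rewrite /phi; case: cid => f [_ _ fg] /=; apply: fg. Qed.

Local Notation H := (A1_Hhat alpha sigma1 sigma2 form).
Local Notation Hg := (@Hhat R V alpha sigma1 sigma2 form).
Local Notation dg := (@dhat R V alpha sigma1 sigma2 form).
Local Notation Xg b := (lie_gen rel (gX b) : L).

Lemma rel_HH (b g : Ppm) : Hg b ∙ Hg g = 0.
Proof.
by rewrite -lie_class_br -lie_class0; apply/lie_classP/lc_rel/A1_rel2.
Qed.

Lemma rel_HX (b g : Ppm) : Hg b ∙ Xg g = (form (val g) (coroot form (val b)))%:C *: Xg g.
Proof.
by rewrite -lie_class_br -lie_classZ; apply/lie_classP/lc_rel/A1_rel3.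
Qed.

Lemma rel_XX (b b' : Ppm) : val b' = - val b -> Xg b ∙ Xg b' = Hg b.
Proof.
by move=> e; rewrite -lie_class_br; apply/lie_classP/lc_rel/A1_rel4.
Qed.

Definition bracket_word (c : Ppm) (s : seq Ppm) : L :=
  lie_class rel (nested_br 'X_c [seq 'X_e | e <- s]).

Lemma bracket_word1 c : bracket_word c [::] = Xg c. Proof. by []. Qed.

Lemma bracket_word_cons c e s : bracket_word c (e :: s) = Xg c ∙ bracket_word e s.
Proof. by rewrite -lie_class_br. Qed.

Lemma rel_word c s : ~ Rs (\sum_(e <- c :: s) val e) -> bracket_word c s = 0.
Proof. by move=> nR; rewrite -lie_class0; apply/lie_classP/lc_rel/A1_rel5. Qed.

Lemma rel_dX i (b : Ppm) : dg i ∙ Xg b = (lam i (val b))%:C *: Xg b.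
Proof.
by rewrite -lie_class_br -lie_classZ; apply/lie_classP/lc_rel/A1_rel6X.
Qed.

Lemma rel_dd i j : dg i ∙ dg j = 0.
Proof.
by rewrite -lie_class_br -lie_class0; apply/lie_classP/lc_rel/A1_rel6d.
Qed.

Lemma rel_dH i (b : Ppm) : dg i ∙ Hg b = 0.
Proof.
by rewrite -lie_class_br -lie_class0; apply/lie_classP/lc_rel/A1_rel6H.
Qed.

(** ** Weights *)

Definition wt b (z : L) : R[i] :=
  2 * (lev b)%:C * coeff (Mon (0, (true, false))) (phi z) +
  ((lam 0 b)%:C * coeff (Der 0) (phi z) + (lam 1 b)%:C * coeff (Der 1) (phi z)).

Lemma wt_linear b a x y : wt b (a *: x + y) = a * wt b x + wt b y.
Proof. by rewrite /wt phi_linear !coeffD !coeffZ; ring. Qed.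

Lemma wt_linearl (r : R) b c z : wt (r *: b + c) z = r%:C * wt b z + wt c z.
Proof. by rewrite /wt lev_linear !lam_linear !rmorphD !rmorphM /=; ring. Qed.

Lemma wtD b c z : wt (b + c) z = wt b z + wt c z.
Proof. by have := wt_linearl 1 b c z; rewrite scale1r rmorph1 mul1r. Qed.

Lemma wt0 z : wt 0 z = 0.
Proof. by rewrite /wt lev0 !lam0 !(rmorph0, mul0r, mulr0, addr0). Qed.

Lemma coeff_cartan_of v :
  [/\ coeff (Mon (0, (true, false))) (cartan_of v) = (lev v)%:C,
      forall i, coeff (Cen i) (cartan_of v) = 2^-1 * (lam i v)%:C
    & forall i, coeff (Der i) (cartan_of v) = 0].
Proof.
have ord2 (i : 'I_2) : i = 0 \/ i = 1.
  by case: i => [[|[|//]]] lti; [left|right]; apply: val_inj.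
rewrite /cartan_of /torus_h; split=> [|i|i]; rewrite !coeffD !coeffZ !coeffD !coeffZ !coeff_basis.
- by rewrite eqxx !mulr0 !addr0 mulr0 addr0 mulr1.
- by rewrite mulr0 add0r; case: (ord2 i) => ->; rewrite eqxx /= mulr0 mulr1 ?addr0 ?add0r.
- by rewrite !mulr0 !addr0 mulr0 addr0.
Qed.

Lemma wt_H b (g : Ppm) : wt b (Hg g) = (form b (coroot form (val g)))%:C.
Proof.
have [k [m [n [eg hk _]]]] := Ppm_pt g.
have [c1 c2 c3] := coeff_cartan_of (val g).
rewrite /wt phi_gen -[gen_image _]/(cartan_of (val g)) c1 !c3 !mulr0 !addr0.
rewrite eg (corootE basisV psd alpha2 rad) //.
by rewrite (formE basisV psd alpha2 rad) !rmorphM /= mulrA rmorph_nat.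
Qed.

Lemma wt_d b i : wt b (dg i) = (lam i b)%:C.
Proof.
rewrite /wt phi_gen [gen_image _]/= !coeff_basis mulr0 add0r.
have [->|->] : i = 0 \/ i = 1 by case: i => [[|[|//]]] lti; [left|right]; apply: val_inj.
- by rewrite eqxx /= mulr0 mulr1 addr0.
- by rewrite eqxx /= mulr0 mulr1 add0r.
Qed.

Definition weight b : set L := [set x | forall h, H h -> h ∙ x = wt b h *: x].

Lemma weight_gen b x : (forall g, Hg g ∙ x = wt b (Hg g) *: x) ->
  (forall i, dg i ∙ x = wt b (dg i) *: x) -> weight b x.
Proof.
move=> hH hd h [n [c [a [ha ->]]]].
have wtS (F : 'I_n -> L) : wt b (\sum_(i < n) F i) = \sum_(i < n) wt b (F i).
  apply: big_morph => [y z|]; first by rewrite -[y in LHS]scale1r wt_linear mul1r.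
  by apply: (addrI (wt b 0)); have := wt_linear b 1 0 0; rewrite scale1r !addr0 mul1r.
have wtZ k z : wt b (k *: z) = k * wt b z.
  have w0 : wt b 0 = 0.
    by apply: (addrI (wt b 0)); have := wt_linear b 1 0 0; rewrite scale1r !addr0 mul1r.
  by rewrite -[k *: z]addr0 wt_linear w0 addr0.
rewrite lie_suml wtS scaler_suml; apply: eq_bigr => i _.
rewrite lieZl wtZ -scalerA; congr (_ *: _).
by case: (ha i) => -[j _ <-].
Qed.

Lemma H_Hg g : H (Hg g). Proof. by apply: lspan_gen; left; exists g. Qed.

Lemma H_dg i : H (dg i). Proof. by apply: lspan_gen; right; exists i. Qed.

Lemma wt_inj b c : (forall h, H h -> wt b h = wt c h) -> b = c.
Proof.
move=> e; apply: (coord_inj basisV) => [|i]; last first.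
  by have := e _ (H_dg i); rewrite !wt_d => -[].
have Pa : Ppm alpha by left; left; left.
pose a : Ppm := SigSub (mem_set Pa).
have := e _ (H_Hg a); rewrite !wt_H /= => -[].
have -> : coroot form alpha = alpha.
  have := @corootE _ _ _ _ _ _ basisV psd alpha2 rad 1 0 0 (or_introl erefl).
  by rewrite -alpha_pt.
rewrite !(formE basisV psd alpha2 rad) => /(mulfI _); rewrite pnatr_eq0 => /(_ isT).
have -> : lev alpha = 1 by have := lev_pt basisV 1 0 0; rewrite -alpha_pt.
by rewrite !mulr1.
Qed.

Lemma weight_lie b c x y : weight b x -> weight c y -> weight (b + c) (x ∙ y).
Proof.
by move=> wx wy h Hh; rewrite lieL (wx h Hh) (wy h Hh) lieZl lieZr -scalerDl -wtD.
Qed.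

Lemma weightZ b a x : weight b x -> weight b (a *: x).
Proof. by move=> wx h Hh; rewrite lieZr (wx h Hh) !scalerA mulrC. Qed.

Lemma weight_X (g : Ppm) : weight (val g) (Xg g).
Proof. by apply: weight_gen => [h|i]; rewrite ?rel_HX ?rel_dX ?wt_H ?wt_d. Qed.

Lemma weight_word c s : weight (\sum_(e <- c :: s) val e) (bracket_word c s).
Proof.
elim: s c => [|e s IHs] c; first by rewrite big_seq1; apply: weight_X.
by rewrite big_cons bracket_word_cons; apply: weight_lie (weight_X c) (IHs e).
Qed.

Lemma weight_H z : H z -> weight 0 z.
Proof.
have gen0 x : (forall g, Hg g ∙ x = 0) -> (forall i, dg i ∙ x = 0) -> weight 0 x.
  by move=> h1 h2; apply: weight_gen => [g|i]; rewrite ?h1 ?h2 wt0 scale0r.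
have Hgz z' : H z' -> (forall g, Hg g ∙ z' = 0) /\ (forall i, dg i ∙ z' = 0).
  move=> [n [c [a [ha ->]]]]; split=> j; rewrite lie_sumr big1 // => i _; rewrite lieZr.
    case: (ha i) => -[g _ <-]; first by rewrite rel_HH scaler0.
    by rewrite lieC rel_dH oppr0 scaler0.
  by case: (ha i) => -[g _ <-]; rewrite ?rel_dH ?rel_dd scaler0.
by move=> /Hgz[]; apply: gen0.
Qed.

Lemma lie_HH x y : H x -> H y -> x ∙ y = 0.
Proof. by move=> Hx /weight_H/(_ x Hx); rewrite wt0 scale0r. Qed.

Lemma weight_uniq b c x : weight b x -> weight c x -> x != 0 -> b = c.
Proof.
move=> wb wc x0; apply: wt_inj => h Hh; apply/eqP; rewrite -subr_eq0.
have /eqP : (wt b h - wt c h) *: x = 0 by rewrite scalerBl -(wb h Hh) -(wc h Hh) subrr.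
by rewrite scaler_eq0 (negbTE x0) orbF.
Qed.

(** ** Spanning by iterated brackets of root vectors *)

(** Carrying the weight as an index lets a vector be expanded into weight vectors
    and its components of a given weight be selected. *)
Definition atom b z := (b = 0 /\ H z) \/ exists c s a,
  [/\ Rs b, b = \sum_(e <- c :: s) val e & z = a *: bracket_word c s].

Definition atomic z := exists2 s : seq (V * L),
  (forall p, p \in s -> atom p.1 p.2) & z = \sum_(p <- s) p.2.

Lemma weight_atom b z : atom b z -> weight b z.
Proof.
case=> [[-> Hz]|[c [s [a [_ -> ->]]]]]; first exact: weight_H.
exact/weightZ/weight_word.
Qed.

Lemma root0 : Rs 0.
Proof. by left; exists 0, 0; rewrite !mulr0z addr0. Qed.

Lemma atom_root b z : atom b z -> Rs b.
Proof. by case=> [[-> _]|[c [s [a []]]]] //; apply: root0. Qed.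

Lemma atomic0 : atomic 0.
Proof. by exists [::] => //; rewrite big_nil. Qed.

Lemma atomic_atom b z : atom b z -> atomic z.
Proof.
move=> az; exists [:: (b, z)]; last by rewrite big_seq1.
by move=> p; rewrite inE => /eqP ->.
Qed.

Lemma atomicD x y : atomic x -> atomic y -> atomic (x + y).
Proof.
move=> [s hs ->] [t ht ->]; exists (s ++ t); last by rewrite big_cat.
by move=> p; rewrite mem_cat => /orP[/hs|/ht].
Qed.

Lemma atomZ b a z : atom b z -> atom b (a *: z).
Proof.
case=> [[-> Hz]|[c [s [d [Rb e ->]]]]].
  by left; split=> //; rewrite -[_ *: _]addr0; apply: lspan_linear => //; apply: lspan0.
by right; exists c, s, (a * d); rewrite scalerA; split.
Qed.

Lemma atomicZ a x : atomic x -> atomic (a *: x).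
Proof.
move=> [s hs ->]; exists [seq (p.1, a *: p.2) | p <- s].
  by move=> p /mapP[q /hs aq ->] /=; apply: atomZ.
by rewrite big_map scaler_sumr.
Qed.

Lemma root_Ppm (c : Ppm) : Rs (val c).
Proof.
have [k [m [n [-> hk pmn]]]] := Ppm_pt c.
by apply/(A1_RP basisV); exists k, m, n; split=> //; right.
Qed.

Lemma atomic_lie x z : (forall b (w : L), atom b w -> atomic (x ∙ w)) ->
  atomic z -> atomic (x ∙ z).
Proof.
move=> hx [s hs ->]; rewrite lie_sumr big_seq.
apply: (big_ind atomic) => [||p ps]; first exact: atomic0.
  exact: atomicD.
exact: hx (hs p ps).
Qed.

(** Prefixing a root vector to an iterated bracket gives either another one whose
    weight is a root, or zero by the defining relations. *)
Lemma atomic_gen (x : gen) z : atomic z -> atomic (lie_gen rel x ∙ z).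
Proof.
apply: atomic_lie => b w aw.
have hH h : H h -> atomic (h ∙ w).
  by move=> Hh; rewrite (weight_atom aw Hh); apply/atomicZ/(atomic_atom aw).
case: x => [c|g|i]; [|exact: (hH _ (H_Hg g))|exact: (hH _ (H_dg i))].
case: aw => [[_ Hw]|[e [s [a [_ _ ->]]]]].
  rewrite lieC (weight_X c Hw) -scaleN1r; do 2!apply: atomicZ.
  apply: (@atomic_atom (val c)); right; exists c, [::], 1.
  by rewrite big_seq1 scale1r; split=> //; apply: root_Ppm.
rewrite lieZr -bracket_word_cons; apply: atomicZ.
have [Rb|nR] := pselect (Rs (\sum_(d <- [:: c, e & s]) val d)).
  apply: (atomic_atom (b := \sum_(d <- [:: c, e & s]) val d)); right.
  by exists c, (e :: s), 1; rewrite scale1r; split.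
by rewrite rel_word //; apply: atomic0.
Qed.

(** The elements whose [ad] preserves the span of atoms are closed under brackets
    by the Jacobi identity, so they are everything. *)
Lemma atomicT z : atomic z.
Proof.
suff h (u : lie_word R[i] gen) :
    (forall w : L, atomic w -> atomic (lie_class rel u ∙ w)) /\ atomic (lie_class rel u).
  by elim/lie_class_ind: z => u; case: (h u).
elim: u => [x||u [IHu Su] v [IHv Sv]|a u [IHu Su]|u [IHu Su] v [IHv Sv]].
- split; first exact: atomic_gen.
  case: x => [c|g|i].
  + apply: (@atomic_atom (val c)); right; exists c, [::], 1.
    by rewrite big_seq1 scale1r; split=> //; apply: root_Ppm.
  + by apply: (@atomic_atom 0); left; split=> //; apply: H_Hg.
  + by apply: (@atomic_atom 0); left; split=> //; apply: H_dg.
- by rewrite lie_class0; split=> [w _|]; rewrite ?lie0l; apply: atomic0.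
- rewrite lie_classD; split=> [w Sw|]; last exact: atomicD.
  by rewrite lieDl; apply: atomicD; [apply: IHu | apply: IHv].
- rewrite lie_classZ; split=> [w Sw|]; last exact: atomicZ.
  by rewrite lieZl; apply/atomicZ/IHu.
- rewrite lie_class_br; split=> [w Sw|]; last exact: IHu.
  rewrite lieA -scaleN1r; apply: atomicD; first exact/IHu/IHv.
  by apply/atomicZ/IHv/IHu.
Qed.

(** ** The three triples *)

Definition apt (i : 'I_3) : V :=
  pt 1 (if i == 1 then -1 else 0) (if i == 2 then -1 else 0).

Lemma Ppm_apt i : Ppm (apt i).
Proof.
by apply/Ppm_cases; left; case: (ord3P i); [constructor 1|constructor 2|constructor 3].
Qed.

Lemma Ppm_Napt i : Ppm (- apt i).
Proof.
apply/Ppm_cases; right; rewrite /apt pt_opp.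
by case: (ord3P i); [constructor 1|constructor 2|constructor 3].
Qed.

Definition pos i : Ppm := SigSub (mem_set (Ppm_apt i)).
Definition neg i : Ppm := SigSub (mem_set (Ppm_Napt i)).

Lemma pos_or_neg (g : Ppm) : exists i, g = pos i \/ g = neg i.
Proof.
have /Ppm_cases := set_valP g.
by case=> [] [] e; [exists 0; left|exists 1; left|exists 2; left
  |exists 0; right|exists 1; right|exists 2; right]; apply: val_inj; rewrite e /= /apt ?pt_opp.
Qed.

Definition xx i : L := Xg (pos i).
Definition yy i : L := Xg (neg i).

Lemma lie_xy i : xx i ∙ yy i = Hg (pos i).
Proof. exact: rel_XX. Qed.

Lemma Hg_neg i : Hg (neg i) = - Hg (pos i).
Proof.
by rewrite -lie_xy lieC opprK; apply/esym/rel_XX; rewrite /= opprK.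
Qed.

Lemma wt_pos i k m n : wt (pt k m n) (Hg (pos i)) = (2 * k)%:~R.
Proof.
rewrite wt_H /= (corootE basisV psd alpha2 rad); last by left.
rewrite (formE basisV psd alpha2 rad) !(lev_pt basisV) mulr1.
by rewrite -(intrM _ 2) rmorph_int.
Qed.

Lemma weight_level k m n z : weight (pt k m n) z -> level xx yy (2 * k) z.
Proof. by move=> wz i; rewrite lie_xy (wz _ (H_Hg _)) wt_pos. Qed.

(** The roots have level -2, 0 or 2, so [ad h (ad h - 2) (ad h + 2) = 0]. *)
Lemma cubic_H z : Hg (pos 0) ∙ Hg (pos 0) ∙ Hg (pos 0) ∙ z = 4 *: (Hg (pos 0) ∙ z).
Proof.
have [s hs ->] := atomicT z; rewrite !lie_sumr scaler_sumr big_seq [RHS]big_seq.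
apply: eq_bigr => p /hs ap.
have /(A1_RP basisV)[k [m [n [e hk]]]] := atom_root ap.
have := weight_atom ap; rewrite e => wp.
have hp : Hg (pos 0) ∙ p.2 = (2 * k)%:~R *: p.2 by rewrite (wp _ (H_Hg _)) wt_pos.
rewrite !(hp, lieZr) !scalerA; congr (_ *: _).
by case: hk => [->|[[->|->] _]]; ring.
Qed.

Lemma triples_xy : triples xx yy.
Proof.
have pos_level i : level xx yy 2 (xx i) by apply: (weight_level (weight_X (pos i))).
have neg_level i : level xx yy (- 2) (yy i).
  by have := weight_X (neg i); rewrite /= pt_opp => /weight_level.
have top (n : int) (v : L) : level xx yy n v -> n * n * n - 4 * n <> 0 -> v = 0.
  move=> lv n0; have hv : Hg (pos 0) ∙ v = n%:~R *: v by rewrite -lie_xy.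
  have := cubic_H v; rewrite !(hv, lieZr) !scalerA => /eqP.
  rewrite -subr_eq0 -scalerBl scaler_eq0 => /orP[|/eqP //].
  rewrite -(rmorph_nat intr 4) -!intrM -intrB intr_eq0 => /eqP e.
  by case: n0; rewrite -e; lia.
have not_root i j k : uniq [:: i; j; k] -> ~ Rs (apt i + (- apt j + apt k)).
  move=> ijk /(A1_RP basisV)[k' [m' [n' [+ hr]]]].
  move: ijk; rewrite /apt !pt_opp !pt_add.
  by case: (ord3P i) (ord3P j) (ord3P k) => [] [] [] //= _ /(pt_inj basisV)[e1 e2 e3];
    move: hr; rewrite /is_root -e1 -e2 -e3 /parity /=; case=> [|[]].
have not_root' i j k : uniq [:: i; j; k] -> ~ Rs (- apt i + (apt j + - apt k)).
  move=> ijk /(A1_RP basisV)[k' [m' [n' [+ hr]]]].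
  move: ijk; rewrite /apt !pt_opp !pt_add.
  by case: (ord3P i) (ord3P j) (ord3P k) => [] [] [] //= _ /(pt_inj basisV)[e1 e2 e3];
    move: hr; rewrite /is_root -e1 -e2 -e3 /parity /=; case=> [|[]].
have two i j : xx i ∙ xx j = 0.
  by apply: (top 4) => //; apply: (level_lie (pos_level i) (pos_level j)).
have two' i j : yy i ∙ yy j = 0.
  by apply: (top (-4)) => //; apply: (level_lie (neg_level i) (neg_level j)).
split=> //.
- by move=> v lv; apply: (top 4).
- by move=> v lv; apply: (top (-4)).
- move=> i j k ijk; rewrite lieA two lie0r subr0.
  have -> : xx i ∙ yy j ∙ xx k = bracket_word (pos i) [:: neg j; pos k].
    by rewrite !bracket_word_cons.
  rewrite rel_word //.
  by rewrite !big_cons big_nil addr0; apply: not_root.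
- move=> i j k ijk; rewrite lieA two' lie0r subr0.
  have -> : yy i ∙ xx j ∙ yy k = bracket_word (neg i) [:: pos j; neg k].
    by rewrite !bracket_word_cons.
  rewrite rel_word //.
  by rewrite !big_cons big_nil addr0; apply: not_root'.
Qed.

Lemma shape_word c s : bracket_shape xx yy (bracket_word c s).
Proof.
have shape1 (g : Ppm) (w : L) : bracket_shape xx yy w -> bracket_shape xx yy (Xg g ∙ w).
  have [i [->|->]] := pos_or_neg g; first exact: (shape_lie_x triples_xy).
  exact: (shape_lie_y triples_xy).
elim: s c => [|e s IHs] c; last by rewrite bracket_word_cons; apply: shape1.
rewrite bracket_word1; have [i [->|->]] := pos_or_neg c.
  exact: (shape_x xx yy i).
exact: (shape_y triples_xy i).
Qed.

(** Otherwise [H_b = [X_b, X_(-b)]] would vanish, but its image does not. *)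
Lemma xx_neq0 i : xx i != 0.
Proof.
apply/eqP => x0; have := congr1 phi (lie_xy i).
rewrite x0 lie0l phi_gen [gen_image _]/=; have [c1 _ _] := coeff_cartan_of (apt i).
have -> : phi 0 = 0.
  by apply: (addrI (phi 0)); have := phi_linear 1 0 0; rewrite !scale1r !addr0.
move=> /(congr1 (coeff (Mon (0, (true, false))))); rewrite c1 coeff0 /apt (lev_pt basisV).
by move/eqP; rewrite rmorph1 eq_sym oner_eq0.
Qed.

(** ** Root spaces *)

Definition vwt p (a b : int) : V := apt p + pt 0 (- (a + a)) (- (b + b)).

Lemma vwtE p (a b : int) : vwt p a b =
  pt 1 ((if p == 1 then -1 else 0) - (a + a)) ((if p == 2 then -1 else 0) - (b + b)).
Proof. by rewrite /vwt /apt pt_add. Qed.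

Lemma vwt_inj p (a b : int) p' (a' b' : int) :
  vwt p a b = vwt p' a' b' -> [/\ p = p', a = a' & b = b'].
Proof.
rewrite !vwtE => /(pt_inj basisV)[_].
by case: (ord3P p) (ord3P p') => [] [] //= e1 e2; split=> //; lia.
Qed.

(** The weights of the [vec p a b] exhaust the roots of level 2, each once: [p] is
    given by the parities, and shifting moves by [2 sigma_i]. *)
Lemma vwt_surj m n : ~~ (parity m && parity n) ->
  exists p (a b : int), pt 1 m n = vwt p a b.
Proof.
have [a em] := parityE m; have [b en] := parityE n.
case pm: (parity m); case pn: (parity n) => // _; rewrite pm pn in em en.
- exists 1, (- a - 1), (- b); rewrite vwtE em en /=; congr pt; lia.
- exists 2, (- a), (- b - 1); rewrite vwtE em en /=; congr pt; lia.
- exists 0, (- a), (- b); rewrite vwtE em en /=; congr pt; lia.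
Qed.

Lemma weight_xx i : weight (apt i) (xx i). Proof. exact: (weight_X (pos i)). Qed.
Lemma weight_yy i : weight (- apt i) (yy i). Proof. exact: (weight_X (neg i)). Qed.

Lemma weight_quad i b z : weight b z -> weight (apt i + apt i + b) (quad xx i z).
Proof.
move=> wz; rewrite quadE -addrA; apply: weightZ.
exact: (weight_lie (weight_xx i) (weight_lie (weight_xx i) wz)).
Qed.

Lemma weight_quady i b z : weight b z -> weight (b - apt i - apt i) (quad yy i z).
Proof.
move=> wz; rewrite quadE -addrA addrC -addrA; apply: weightZ.
exact: (weight_lie (weight_yy i) (weight_lie (weight_yy i) wz)).
Qed.

Definition dbl (i j : 'I_3) : V := apt i + apt i - (apt j + apt j).

Lemma weight_shift i j b z : weight b z -> weight (b + dbl i j) (shift xx yy i j z).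
Proof.
move=> wz; have -> : b + dbl i j = apt i + apt i + (b - apt j - apt j).
  by rewrite /dbl addrCA opprD [b + (_ + _)]addrA.
exact: weight_quad (weight_quady j wz).
Qed.

Lemma weight_iterz i (n : int) b z : weight b z ->
  weight (b + dbl i 0 *~ n) (iterz (shift xx yy i 0) (shift xx yy 0 i) n z).
Proof.
move=> wz; have dblN : dbl 0 i = - dbl i 0 by rewrite /dbl opprB.
have it (f : L -> L) v (m : nat) : (forall c (w : L), weight c w -> weight (c + v) (f w)) ->
    weight (b + v *+ m) (iter m f z).
  by move=> wf; elim: m => [|m IHm]; rewrite ?addr0 // mulrSr addrA; apply: wf.
case: n => m; first by apply: it => c w; apply: weight_shift.
rewrite NegzE mulrNz -mulNrz -dblN.
by apply: (it _ _ m.+1) => c w; apply: weight_shift.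
Qed.

Lemma weight_vec p (a b : int) : weight (vwt p a b) (vec xx yy p a b).
Proof.
have := weight_iterz 1 a (weight_iterz 2 b (weight_xx p)).
rewrite -addrA; congr weight; congr (_ + _).
rewrite /dbl /apt /= !pt_add !pt_opp !pt_add !pt_mulz pt_add.
congr pt; lia.
Qed.

Lemma vec_neq0_xy p (a b : int) : vec xx yy p a b != 0.
Proof. exact/(vec_neq0 triples_xy)/xx_neq0. Qed.

Lemma lev_vec_xy p (a b : int) : level xx yy 2 (vec xx yy p a b).
Proof. exact: (lev_vec triples_xy). Qed.

(** The atoms of the other weights cancel, by independence of weight spaces. *)
Lemma weight_atoms b z : weight b z ->
  exists2 s : seq L, (forall w : L, w \in s -> atom b w) & z = \sum_(w <- s) w.
Proof.
move=> wz; have [s hs ez] := atomicT z.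
pose op (o : set_type H) : L := val o.
have sep c d : c <> d -> exists o : set_type H, wt c (op o) <> wt d (op o).
  move=> cd; apply: contrapT => /forallNP eo; apply: cd; apply: wt_inj => h Hh.
  by have /contrapT := eo (SigSub (mem_set Hh)).
have ev p : p \in (b, - z) :: s -> forall o, op o ∙ p.2 = wt p.1 (op o) *: p.2.
  have Ho o : H (op o) by apply: set_valP.
  rewrite inE => /orP[/eqP -> o /=|/hs ap o]; last exact: weight_atom ap _ (Ho o).
  by rewrite lieNr (wz _ (Ho o)) scalerN.
have s0 : \sum_(p <- (b, - z) :: s) p.2 = 0 by rewrite big_cons /= ez addNr.
have := weight_separation sep ev s0 b; rewrite big_cons /= eqxx => /eqP.
rewrite addrC subr_eq0 => /eqP e.
exists [seq p.2 | p <- s & p.1 == b]; last by rewrite big_map big_filter e.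
move=> w /mapP[p]; rewrite mem_filter => /andP[/eqP <- ps] ->; exact: hs.
Qed.

Lemma atom_line p (a b : int) (w : L) :
  atom (vwt p a b) w -> exists c, w = c *: vec xx yy p a b.
Proof.
move=> aw; have ww := weight_atom aw.
have [->|w0] := eqVneq w 0; first by exists 0; rewrite scale0r.
case: aw => [[v0 _]|[c [s [d [_ _ ew]]]]].
  by move: v0; rewrite vwtE -(pt0 alpha sigma1 sigma2) => /(pt_inj basisV)[].
have [d0 t0] : d != 0 /\ bracket_word c s != 0.
  by apply/andP; rewrite -negb_or -scaler_eq0 -ew.
have wt_t : weight (vwt p a b) (bracket_word c s).
  by have := weightZ d^-1 ww; rewrite ew scalerA mulVf // scale1r.
have [v [q [a' [b' [e ev]]]] hsh] := shape_word c s.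
have wv : weight (vwt q a' b') v by rewrite ev; apply/weightZ/weight_vec.
case: hsh => [et|et|[j et]|[j et]].
- have := weight_uniq wt_t (_ : weight (vwt q a' b') _) t0; rewrite {1}et => /(_ wv).
  by move=> /vwt_inj[-> -> ->]; exists (d * e); rewrite ew et ev scalerA.
- have := weight_quady 0 wv; rewrite -et => /(weight_uniq wt_t)/(_ t0).
  by rewrite !vwtE /apt !pt_opp !pt_add => /(pt_inj basisV)[].
- have := weight_lie (weight_yy j) wv; rewrite -et => /(weight_uniq wt_t)/(_ t0).
  by rewrite !vwtE /apt !pt_opp !pt_add => /(pt_inj basisV)[].
- have := weight_lie (weight_xx j) (weight_quady 0 wv).
  rewrite -et => /(weight_uniq wt_t)/(_ t0).
  by rewrite !vwtE /apt !pt_opp !pt_add => /(pt_inj basisV)[].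
Qed.

Lemma weight_pos_line p (a b : int) (z : L) :
  weight (vwt p a b) z -> exists c, z = c *: vec xx yy p a b.
Proof.
move=> /weight_atoms[s hs ->].
have : forall w : L, w \in s -> exists c, w = c *: vec xx yy p a b.
  by move=> w /hs/atom_line.
elim: s {hs} => [|w s IHs] hs; first by exists 0; rewrite big_nil scale0r.
have [c e] := hs w (mem_head _ _).
have [|d ed] := IHs; first by move=> w' w's; apply: hs; rewrite inE w's orbT.
by exists (c + d); rewrite big_cons e ed scalerDl.
Qed.

Lemma weight_neg_line p (a b : int) (z : L) :
  weight (vwt p a b - apt 0 - apt 0) z ->
  exists c, z = c *: quad yy 0 (vec xx yy p a b).
Proof.
move=> wz; have lz : level xx yy (- 2) z.
  move: wz; rewrite vwtE /apt !pt_opp !pt_add; exact: weight_level.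
have := weight_quad 0 wz.
have -> : apt 0 + apt 0 + (vwt p a b - apt 0 - apt 0) = vwt p a b.
  by rewrite addrC addrA !subrK.
move=> /weight_pos_line[c e]; exists c.
by rewrite -quadZ -e (quadyK triples_xy).
Qed.

Lemma quady_vec_neq0 p (a b : int) : quad yy 0 (vec xx yy p a b) != 0.
Proof.
apply: contra_neq (vec_neq0_xy p a b) => e.
rewrite -(quadK 0 triples_xy (lev_vec_xy p a b)) e.
by rewrite -(scale0r (0 : L)) quadZ !scale0r.
Qed.

(** A root of level 0 is [vwt p a c - apt j] for some [j], and [yy j] is injective
    on level 2 since [xx j] undoes it up to a factor 2. *)
Lemma root_space_neq0 b : Rs b -> exists2 z, weight b z & z != 0.
Proof.
move=> /(A1_RP basisV)[k [m [n [-> [->|[[->|->] pmn]]]]]].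
- have [j [p [a [c e]]]] : exists j p (a c : int), pt 0 m n = - apt j + vwt p a c.
    have [/andP[pm pn]|pmn] := boolP (parity m && parity n).
      have [|p [a [c e]]] := @vwt_surj (m - 1) n.
        by rewrite -{1}[m - 1]opprK parityN /parity in pm *; lia.
      by exists 1, p, a, c; rewrite -e /apt /= pt_opp pt_add; congr pt; lia.
    have [p [a [c e]]] := vwt_surj pmn.
    by exists 0, p, a, c; rewrite -e /apt /= pt_opp pt_add; congr pt; lia.
  exists (yy j ∙ vec xx yy p a c).
    by rewrite e; apply: weight_lie (weight_yy j) (weight_vec p a c).
  apply: contra_neq (vec_neq0_xy p a c) => y0.
  apply: (@scalerI _ _ (2 : C)); first by rewrite pnatr_eq0.
  rewrite scaler0 -(Dii j (lev_vec_xy p a c)) (D_top triples_xy) ?y0 ?lie0r //.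
  exact: lev_vec_xy.
- have [p [a [c ->]]] := vwt_surj pmn; exists (vec xx yy p a c); first exact: weight_vec.
  exact: vec_neq0_xy.
- have [p [a [c e]]] := vwt_surj pmn; exists (quad yy 0 (vec xx yy p a c));
    last exact: quady_vec_neq0.
  suff -> : pt (-1) m n = vwt p a c - apt 0 - apt 0 by apply/weight_quady/weight_vec.
  by rewrite -e /apt /= !pt_opp !pt_add; congr pt; lia.
Qed.

Lemma root_space_dim1 b : aniso alpha sigma1 sigma2 form b ->
  exists2 z : L, weight b z /\ z != 0 &
    forall w : L, weight b w -> exists c, w = c *: z.
Proof.
move=> /(anisoP basisV psd alpha2 rad)[k [m [n [-> [->|->] pmn]]]].
- have [p [a [c ->]]] := vwt_surj pmn; exists (vec xx yy p a c).
    by split; [apply: weight_vec | apply: vec_neq0_xy].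
  by move=> w; apply: weight_pos_line.
- have [p [a [c e]]] := vwt_surj pmn.
  have -> : pt (-1) m n = vwt p a c - apt 0 - apt 0.
    by rewrite -e /apt /= !pt_opp !pt_add; congr pt; lia.
  exists (quad yy 0 (vec xx yy p a c)).
    by split; [apply/weight_quady/weight_vec | apply: quady_vec_neq0].
  by move=> w; apply: weight_neg_line.
Qed.

(** ** The Cartan subalgebra *)

Lemma phi_pos i : phi (Hg (pos i)) = cartan_of (apt i).
Proof. exact: phi_gen. Qed.

Lemma phi_dg i : phi (dg i) = << Der i >>.
Proof. exact: phi_gen. Qed.

(** In the image the central components separate the three [H_b], although these
    have the same action. *)
Lemma cartan_free c0 c1 c2 c3 c4 :
  c0 *: Hg (pos 0) + (c1 *: Hg (pos 1) + (c2 *: Hg (pos 2) + (c3 *: dg 0 + c4 *: dg 1))) = 0 ->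
  [/\ c0 = 0, c1 = 0, c2 = 0, c3 = 0 & c4 = 0].
Proof.
have phi0 : phi 0 = 0.
  by apply: (addrI (phi 0)); have := phi_linear 1 0 0; rewrite !scale1r !addr0.
have phiZ a z : phi (a *: z) = a *: phi z by rewrite -[a *: z]addr0 phi_linear phi0 addr0.
move=> /(congr1 phi); rewrite !phi_linear phiZ !phi_pos !phi_dg phi0 => e.
have [h0 l0 d0] := coeff_cartan_of (apt 0).
have [h1 l1 d1] := coeff_cartan_of (apt 1).
have [h2 l2 d2] := coeff_cartan_of (apt 2).
move: (cartan_of (apt 0)) (cartan_of (apt 1)) (cartan_of (apt 2)) e h0 l0 d0 h1 l1 d1 h2 l2 d2.
move=> u0 u1 u2 e h0 l0 d0 h1 l1 d1 h2 l2 d2.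
have eb (t : torus_basis) := congr1 (coeff t) e.
have half (c : R[i]) : c * (2^-1 * (-1)%:~R) = 0 -> c = 0.
  move=> /eqP; rewrite mulf_eq0 mulf_eq0 invr_eq0 pnatr_eq0 intr_eq0 /=.
  by rewrite orbF => /eqP.
have c10 : c1 = 0.
  apply: half; have := eb (Cen 0); rewrite !(coeffD, coeffZ) l0 l1 l2 !coeff_basis coeff0.
  rewrite /apt !(lam0_pt basisV) /= !rmorph_int.
  by rewrite !(mulr0z, mulr0, addr0, add0r).
have c20 : c2 = 0.
  apply: half; have := eb (Cen 1); rewrite !(coeffD, coeffZ) l0 l1 l2 !coeff_basis coeff0.
  rewrite /apt !(lam1_pt basisV) /= !rmorph_int.
  by rewrite !(mulr0z, mulr0, addr0, add0r).
have := eb (Mon (0, (true, false))); have := eb (Der 0); have := eb (Der 1).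
rewrite !(coeffD, coeffZ) h0 h1 h2 !d0 !d1 !d2 !coeff_basis coeff0 c10 c20 /=.
rewrite /apt !(lev_pt basisV) !rmorph1 !(mul0r, mulr0, addr0, add0r, mulr1).
by rewrite !coeff0 => -> -> ->.
Qed.

Definition cartan_basis (i : 'I_5) : L :=
  [:: Hg (pos 0); Hg (pos 1); Hg (pos 2); dg 0; dg 1]`_i.

Lemma cartan_basisP : is_basis H cartan_basis.
Proof.
split.
  apply/seteqP; split; apply: lspan_sub => z.
    have Hpos i : lspan (range cartan_basis) (Hg (pos i)).
      apply: lspan_gen; case: (ord3P i).
      - by exists (@Ordinal 5 0 isT).
      - by exists (@Ordinal 5 1 isT).
      - by exists (@Ordinal 5 2 isT).
    case=> -[g _ <-].
      have [i [->|->]] := pos_or_neg g; first exact: Hpos.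
      rewrite Hg_neg -scaleN1r -[_ *: _]addr0.
      by apply: lspan_linear (Hpos i) _; apply: lspan0.
    apply: lspan_gen; case: g => [[|[|//]]] lt2.
    - by exists (@Ordinal 5 3 isT) => //=; congr dhat; apply: val_inj.
    - by exists (@Ordinal 5 4 isT) => //=; congr dhat; apply: val_inj.
  move=> [[[|[|[|[|[|//]]]]] lt5] _ <-];
    [exact: H_Hg | exact: H_Hg | exact: H_Hg | exact: H_dg | exact: H_dg].
move=> c; rewrite !big_ord_recl big_ord0 /cartan_basis /= addr0.
move=> /cartan_free[c0 c1 c2 c3 c4] [[|[|[|[|[|//]]]]] lt5].
- by rewrite -[RHS]c0; congr c; apply: val_inj.
- by rewrite -[RHS]c1; congr c; apply: val_inj.
- by rewrite -[RHS]c2; congr c; apply: val_inj.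
- by rewrite -[RHS]c3; congr c; apply: val_inj.
- by rewrite -[RHS]c4; congr c; apply: val_inj.
Qed.

End Presented.

(** * Roots as functionals on the Cartan subalgebra *)

Section Functionals.
Context {R : realType} {V : vectType R}.
Variables (alpha sigma1 sigma2 : V) (form : V -> V -> R).
Hypothesis basisV : basis_of fullv [:: alpha; sigma1; sigma2].
Hypothesis psd : psd_symmetric_form setT form.
Hypothesis alpha2 : form alpha alpha = 2.
Hypothesis rad : radical setT form = lspan [set sigma1; sigma2].
Local Open Scope complex_scope.

Local Notation Rs := (A1_R alpha sigma1 sigma2).
Local Notation H := (A1_Hhat alpha sigma1 sigma2 form).
Local Notation L := (A1_Lhat alpha sigma1 sigma2 form).
Local Notation wt := (wt basisV psd alpha2 rad).
Local Notation weight := (weight basisV psd alpha2 rad).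

Definition iota (b : V) : functional H := fun h => wt b (val h).

Lemma iota_linear (a : R) u v : iota (a *: u + v) = a *: iota u + iota v.
Proof.
apply/funext => h; rewrite /iota wt_linearl.
have sc (r : R) (z : R[i]) : r%:C * z = r *: (z : Rcomplex R).
  by case: z => x y; rewrite /GRing.mul /= /GRing.scale /= !mul0r subr0 addr0.
by rewrite sc.
Qed.

Lemma iota_inj : injective iota.
Proof.
move=> b c e.
apply: (wt_inj (basisV := basisV) (psd := psd) (alpha2 := alpha2) (rad := rad)) => h Hh.
exact: (congr1 (fun f : functional H => f (SigSub (mem_set Hh))) e).
Qed.

Lemma dual_iota b : dual (iota b).
Proof. by move=> a x y z e; rewrite /iota e wt_linear. Qed.

Lemma weight_space_iota b : weight_space (iota b) = weight b.
Proof.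
apply/seteqP; split=> x wx h; last by apply: wx; apply: set_valP.
by move=> Hh; apply: (wx (SigSub (mem_set Hh))).
Qed.

Lemma regarded_as_iota b : regarded_as b (iota b).
Proof.
split; first exact: dual_iota.
  by move=> g h e; rewrite /iota e wt_H.
by move=> i h e; rewrite /iota e wt_d.
Qed.

Lemma root_system_iota : root_system (H := H) = iota @` Rs.
Proof.
apply/seteqP; split=> f; last first.
  move=> [b Rb <-]; split; first exact: dual_iota.
  have [z wz z0] := root_space_neq0 basisV psd alpha2 rad Rb.
  by exists z => //; rewrite weight_space_iota.
move=> [_ [x fx x0]].
have [[b fb]|nb] := pselect (exists b, f = iota b).
  exists b; last by rewrite fb.
  move: fx; rewrite fb weight_space_iota => /weight_atoms[[|w s] hs ex].
    by move: x0; rewrite ex big_nil eqxx.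
  exact: atom_root (hs w (mem_head _ _)).
(* Otherwise [f] is separated from every weight, hence so is [x] from its own
   expansion into weight vectors. *)
have [s hs ex] := atomicT basisV psd alpha2 rad x.
pose op (o : set_type H) : L := val o.
pose ev (c : option V) (o : set_type H) : R[i] := if c is Some c then wt c (op o) else f o.
have sep c d : c <> d -> exists o, ev c o <> ev d o.
  move=> cd; apply: contrapT => /forallNP eo; apply: cd.
  have {}eo o : ev c o = ev d o by have /contrapT := eo o.
  case: c d eo => [c|] [d|] //= eo.
  - by congr Some; apply: iota_inj; apply/funext => o; apply: eo.
  - by case: nb; exists c; apply/funext => o; rewrite -eo.
  - by case: nb; exists d; apply/funext => o; rewrite eo.
have hev p : p \in (None, - x) :: [seq (Some q.1, q.2) | q <- s] ->
    forall o, op o ∙ p.2 = ev p.1 o *: p.2.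
  rewrite inE => /orP[/eqP -> o /=|/mapP[q /hs aq ->] o /=].
    by rewrite lieNr (fx o) scalerN.
  by apply: weight_atom aq _ _; apply: set_valP.
have s0 : \sum_(p <- (None, - x) :: [seq (Some q.1, q.2) | q <- s]) p.2 = 0.
  by rewrite big_cons big_map /= -ex addNr.
have := weight_separation sep hev s0 None.
rewrite big_cons /= big_map big_pred0 // addr0 => /eqP.
by rewrite oppr_eq0 (negbTE x0).
Qed.

Lemma lspan_roots : lspan (iota @` Rs) = range iota.
Proof.
rewrite lspan_image; last exact: iota_linear.
congr (_ @` _); apply/seteqP; split=> // v _.
have hR k m n : is_root k m n -> Rs (pt alpha sigma1 sigma2 k m n).
  by move=> hk; apply/(A1_RP basisV); exists k, m, n.
have Ra : Rs alpha by have := hR 1 0 0; rewrite -alpha_pt; apply; right; split=> //; left.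
have R1 : Rs sigma1 by have := hR 0 1 0; rewrite -sigma1_pt; apply; left.
have R2 : Rs sigma2 by have := hR 0 0 1; rewrite -sigma2_pt; apply; left.
rewrite (coordE basisV v) -addrA; apply: lspan_linear; first exact: lspan_gen.
apply: lspan_linear; first exact: lspan_gen.
by rewrite -[_ *: _]addr0; apply: lspan_linear (lspan0 _); apply: lspan_gen.
Qed.

(** The form on functionals is the one of [V] read through this inverse. *)
Definition iota_inv (f : functional H) : V :=
  if pselect (exists u, iota u = f) is left e then projT1 (cid e) else 0.

Lemma iotaK u : iota_inv (iota u) = u.
Proof.
rewrite /iota_inv; case: pselect => [e|]; last by case; exists u.
by case: cid => w /= /iota_inj.
Qed.

Lemma subalgebra_H : is_subalgebra H.
Proof.
split; first exact: lspan0.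
split=> [a x y|x y Hx Hy]; first exact: lspan_linear.
by rewrite (lie_HH basisV psd alpha2 rad Hx Hy); apply: lspan0.
Qed.

Lemma weight_decomposition_H : weight_decomposition H.
Proof.
move=> x; have [s hs ->] := atomicT basisV psd alpha2 rad x.
exists (size s), (fun i => iota (tnth (in_tuple s) i).1), (fun i => (tnth (in_tuple s) i).2).
split; last by rewrite (big_tnth _ _ s).
move=> i; split; first exact: dual_iota.
by rewrite weight_space_iota; apply/weight_atom/hs/mem_tnth.
Qed.

End Functionals.

Theorem theorem6p6p2 (R : realType) (V : vectType R) (alpha sigma1 sigma2 : V)
    (form : V -> V -> R)
    (basisV : basis_of fullv [:: alpha; sigma1; sigma2])
    (psd : psd_symmetric_form setT form)
    (alpha2 : form alpha alpha = 2)
    (rad : radical setT form = lspan [set sigma1; sigma2]) :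
  let Rs := A1_R alpha sigma1 sigma2 in
  let H := A1_Hhat alpha sigma1 sigma2 form in
  exists iota : V -> functional H,
    [/\ (forall b, regarded_as b (iota b)) /\ injective iota,
        exists2 B, elliptic_lie_algebra_wrt B
                 & forall u v, B (iota u) (iota v) = form u v,
        root_system (H := H) = iota @` Rs,
        has_dim H 5
      & forall b, anisotropic_roots setT form Rs b ->
          has_dim (weight_space (iota b)) 1].
Proof.
move=> Rs H; exists (iota basisV psd alpha2 rad); split.
- by split; [move=> b; apply: regarded_as_iota | apply: iota_inj].
- pose B f g := form (iota_inv basisV psd alpha2 rad f) (iota_inv basisV psd alpha2 rad g).
  have BE u v : B (iota basisV psd alpha2 rad u) (iota basisV psd alpha2 rad v) = form u v.
    by rewrite /B !iotaK.
  exists B => //; split; [exact: subalgebra_H | exact: weight_decomposition_H | ].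
  rewrite (root_system_iota basisV psd alpha2 rad) lspan_roots.
  apply: (elliptic_image _ _ BE); [exact: iota_linear | exact: iota_inj | exact: A1_elliptic].
- exact: root_system_iota.
- exists (cartan_basis alpha sigma1 sigma2 form); exact: cartan_basisP.
- move=> b ab; have [z [wz z0] hz] := root_space_dim1 basisV psd alpha2 rad ab.
  exists (fun _ => z); rewrite weight_space_iota; split.
    apply/seteqP; split=> w; first by move=> /hz[c ->]; exists 1%N, (fun _ => c), (fun _ => z);
      split; [exists 0 | rewrite big_ord1].
    move=> [n [c [a [ha ->]]]].
    have -> : \sum_(i < n) c i *: a i = (\sum_(i < n) c i) *: z.
      by rewrite scaler_suml; apply: eq_bigr => i _; have [_ _ <-] := ha i.
    exact: weightZ.
  move=> c; rewrite big_ord1 => /eqP; rewrite scaler_eq0 (negbTE z0) orbF => /eqP c0 i.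
  by rewrite -[RHS]c0; congr c; apply: val_inj; case: i => [[]].
Qed.
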